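(* Let $\Omega\subset\mathbb{R}^n$ be an open ball centered at the origin or $\Omega=\mathbb{R}^n$, and let $G=y^i\frac{\partial}{\partial x^i}-2G^i(x,y)\frac{\partial}{\partial y^i}$ be a spray on $\Omega$. Then $G$ is spherically symmetric if and only if there exist smooth functions $\alpha=\alpha(r,s)$ and $\beta=\beta(r,s)$ such that, with $r=|x|^2$ and $s=\langle x,y\rangle/|y|$, for all $i=1,\dots,n$, $$G^i(x,y)=|y|\,\alpha(r,s)\,y^i+|y|^2\,\beta(r,s)\,x^i\quad (y\neq 0),\qquad G^i(x,0)=0.$$
   Context: $|\cdot|$ and $\langle\cdot,\cdot\rangle$ denote the Euclidean norm and inner product on $\mathbb{R}^n$; $T\Omega$ is identified with $\Omega\times\mathbb{R}^n$ with coordinates $(x,y)$. A spray $G$ on $\Omega$ is a smooth vector field on $T\Omega\setminus\{0\}$ (i.e. on $\Omega\times(\mathbb{R}^n\setminus\{0\})$) of the form $G=y^i\frac{\partial}{\partial x^i}-2G^i(x,y)\frac{\partial}{\partial y^i}$, where the coefficients $G^i$ are smooth for $y\ne0$ and positively homogeneous of degree two in $y$: $G^i(x,\lambda y)=\lambda^2G^i(x,y)$ for $\lambda>0$ (extended by $G^i(x,0)=0$). $G$ is spherically symmetric if it is invariant under the diagonal action of $O(n)$: for every $U\in O(n)$ the map $\Psi_U(x,y)=(Ux,Uy)$ satisfies $(\Psi_U)_*G=G$; equivalently $G^i(Ux,Uy)=\sum_j U^i_jG^j(x,y)$ for all $U=(U^i_j)\in O(n)$. Functions of $(r,s)$ are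 considered on the set of values taken by $(|x|^2,\langle x,y\rangle/|y|)$ for $x\in\Omega$, $y\neq0$. *)

(* Defs.v *)
From HB Require Import structures.
From mathcomp Require Import all_boot all_order all_algebra.
From mathcomp Require Import all_classical all_reals all_analysis.
Import Order.TTheory GRing.Theory Num.Theory numFieldNormedType.Exports.

Set Implicit Arguments.
Unset Strict Implicit.
Unset Printing Implicit Defensive.

Local Open Scope classical_set_scope.
Local Open Scope ring_scope.

Section smooth.
Variables (R : realType) (V W : normedModType R).
Implicit Types (f : V -> W) (A : set V).

(* [iter_derive [:: v1; ...; vk] f] is 'D_v1 (... ('D_vk f)). *)
Definition iter_derive (vs : seq V) f : V -> W :=
  foldr (fun v g => 'D_v g) f vs.

(* C^oo on an open set [A], V being finite dimensional in all uses: the iterated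
   directional derivatives of every order exist and are differentiable. *)
Definition smooth_on A f : Prop :=
  forall (vs : seq V) (x : V), A x -> differentiable (iter_derive vs f) x.

(* Smoothness on an arbitrary, not necessarily open, set: near each of its
   points [f] agrees on [A] with a C^oo function on an open neighbourhood. *)
Definition smooth_rel A f : Prop :=
  forall x, A x -> exists (O : set V) (g : V -> W),
    [/\ open O, O x, smooth_on O g & {in O `&` A, g =1 f}].

End smooth.

Section sprays.
Variables (R : realType) (n : nat).
Local Notation E := 'cV[R]_n.
(* E * E is the ambient space of TOmega, with coordinates (x, y), and is also
   the space of tangent vectors (x-components, y-components) at its points. *)
Local Notation TE := (E * E)%type.

(* The norm [`|x|] that MathComp-Analysis puts on matrices is the sup norm, so
   it is not used here; it induces the same topology and derivatives. *)
Definition edot (x y : E) : R := \sum_(i < n) x i ord0 * y i ord0.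
Definition enorm (x : E) : R := Num.sqrt (edot x x).

Definition centered_ball_or_space (Omega : set E) : Prop :=
  (exists2 rho : R, 0 < rho & Omega = [set x | enorm x < rho]) \/
  Omega = setT.

Definition slit_tangent (Omega : set E) : set TE :=
  [set p | Omega p.1 /\ p.2 != 0].

(* The vector field y^i d/dx^i - 2 G^i d/dy^i. *)
Definition spray_field (G : TE -> E) : TE -> TE :=
  fun p => (p.2, - (2 *: G p)).

Definition is_spray (Omega : set E) (G : TE -> E) : Prop :=
  [/\ forall i : 'I_n,
        smooth_on (slit_tangent Omega) (fun p => G p i ord0 : R^o),
      forall (x y : E) (lambda : R), Omega x -> 0 < lambda ->
        G (x, lambda *: y) = lambda ^+ 2 *: G (x, y)
    & forall x : E, Omega x -> G (x, 0) = 0].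

Definition orthogonal_mx (U : 'M[R]_n) : Prop := U^T *m U = 1%:M.

Definition Psi (U : 'M[R]_n) : TE -> TE := fun p => (U *m p.1, U *m p.2).

(* Pushforward of the vector field [F] by a diffeomorphism [phi] with
   inverse [psi]. *)
Definition push_field (phi psi : TE -> TE) (F : TE -> TE) : TE -> TE :=
  fun q => 'd phi (psi q) (F (psi q)).

Definition spherically_symmetric (Omega : set E) (G : TE -> E) : Prop :=
  forall U : 'M[R]_n, orthogonal_mx U ->
    {in slit_tangent Omega,
      push_field (Psi U) (Psi (invmx U)) (spray_field G) =1 spray_field G}.

Definition rs (p : TE) : R^o * R^o :=
  (enorm p.1 ^+ 2, edot p.1 p.2 / enorm p.2).

End sprays.

(* Main.v *)
Require Import Defs.
From HB Require Import structures.
From mathcomp Require Import all_boot all_order all_algebra.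
From mathcomp Require Import all_classical all_reals all_analysis.
From mathcomp Require Import ring lra.
Import Order.TTheory GRing.Theory Num.Theory numFieldNormedType.Exports.

Local Open Scope classical_set_scope.
Local Open Scope ring_scope.

(* An orthogonal map sends (x, y), y <> 0, to (s e1 + t e2, |y| e1) with t the
   square root of r - s^2.  Homogeneity and invariance reduce G to its values
   A e1 + B e2 at (s e1 + t e2, e1), where the reflection e2 -> - e2 makes A even
   and B odd in t; thus beta = B / t and alpha = A - s beta.

   The difficulty is smoothness where t = 0, i.e. on the boundary r = s^2 of the
   set of values of (r, s): an even smooth function K(s, t) must be extended,
   as a function of (s, v) with v = t^2, smoothly to v < 0.  Following Seeley, put
   sum_k b_k K(s, 2^k sqrt(-v)) there, with rapidly decreasing b_k such that
   sum_k b_k 4^(k j) = (-1)^j for all j.  The derivative in v of the glued function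
   is the function of the same kind built from K_t / (2 t), which is smooth and
   even by Hadamard's division lemma, so that C^1 gluing suffices.  The series
   needs K to be bounded with all its derivatives for all t, which is achieved
   locally by the substitution t = d tau / sqrt(1 + tau^2). *)

(** Near a point with [r = s ^ 2] the coefficients must be given on a full neighbourhood, including
    pairs with [r < s ^ 2], which no [(x, y)] attains and where [sqrt (r - s ^ 2)] says nothing. The
    moments are dictated by Taylor expansions: if [K (s, t) ~ sum_j c_j(s) t ^ (2 j)], then
    [sum_k b_k K (s, 2 ^ k sqrt (- v))] expands as [sum_j c_j(s) (sum_k b_k 4 ^ (k j)) (- v) ^ j],
    which is [sum_j c_j(s) v ^ j] when the inner sums are [(-1) ^ j]. A derivation in [v] brings out
    [- 4 ^ k] and replaces [K] by [K_t / (2 t)], so it shifts the moments by one; this is the origin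
    of the index [j] carried by the construction. The dilations by [2 ^ k] leave every ball, so [K]
    must be defined for all [t]. With [t = d tau / sqrt (1 + tau ^ 2)] one has
    [tau ^ 2 = t ^ 2 / (d ^ 2 - t ^ 2)], a smooth function of [t ^ 2 < d ^ 2] that continues to
    negative values: extending in [tau ^ 2] is extending in [t ^ 2]. *)

Set Implicit Arguments.
Unset Strict Implicit.

(** * Functions of class C^k *)

Section differentiability.
Variables (R : realType) (V W : normedModType R).
Implicit Types (f g : V -> W) (x : V).

Lemma is_diff_eps f (df : {linear V -> W}) x : continuous df ->
  (forall e : R, 0 < e ->
    \forall h \near (0 : V), `|f (h + x) - f x - df h| <= e * `|h|) ->
  is_diff x f df.
Proof.
move=> dfc dfP.
have dfE : f \o shift x = cst (f x) + df +o_ (0 : V) id.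
  apply/eqaddoP => e e0; near=> h.
  by rewrite !fctE /= opprD addrA; near: h; exact: dfP.
by split; [apply/diff_locallyP; rewrite (diff_unique dfc dfE)|exact: diff_unique].
Unshelve. all: by end_near. Qed.

Lemma diff_eps f x : differentiable f x -> forall e : R, 0 < e ->
  \forall h \near (0 : V), `|f (h + x) - f x - 'd f x h| <= e * `|h|.
Proof.
move=> /diff_locallyP[_ /eqaddoP dfE] e e0; have := dfE _ e0.
by apply: filterS => h; rewrite !fctE /= opprD addrA.
Qed.

Lemma near_eq_differentiable f g x : (\near x, f x = g x) ->
  differentiable f x -> differentiable g x.
Proof.
move=> fg df; suff : is_diff x g ('d f x) by case.
apply: is_diff_eps; first exact: diff_continuous.
move=> e e0; have dfe := diff_eps df e0.
have fg0 : \forall h \near (0 : V), f (h + x) = g (h + x).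
  move: fg; rewrite (near_shift 0 x) /=; apply: filterS => h /=.
  by rewrite subr0.
near=> h; rewrite -(nbhs_singleton fg); near: h.
by apply: filterS2 dfe fg0 => h + <-.
Unshelve. all: by end_near. Qed.

End differentiability.

Section Ck_functions.
Variable R : realType.
Local Notation R2 := (R^o * R^o)%type.

(* The iterated directional derivatives of [f] of order at most [k] are
   differentiable on [A], cf. [smooth_on], and bounded there when [b] is set. *)
Fixpoint Ck (b : bool) (k : nat) (V : normedModType R) (A : set V)
    (f : V -> R^o) : Prop :=
  [/\ forall x, A x -> differentiable f x,
      b -> exists M : R, forall x, A x -> `|f x| <= M
    & if k is k'.+1 then forall v, Ck b k' A ('D_v f) else True].

Lemma derive_pairE (f : R2 -> R^o) (p v : R2) : differentiable f p ->
  'D_v f p = v.1 * 'D_(1, 0) f p + v.2 * 'D_(0, 1) f p.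
Proof.
move=> df; rewrite !deriveE //.
have {1}-> : v = v.1 *: ((1, 0) : R2) + v.2 *: ((0, 1) : R2).
  case: v => a c /=; congr pair => /=;
  by rewrite /GRing.scale /= !(mulr0, mulr1) ?addr0 ?add0r.
by rewrite linearD !linearZ.
Qed.

Section V.
Variable V : normedModType R.
Implicit Types (A : set V) (f g : V -> R^o).

Lemma Ck_le b k l A f : (l <= k)%N -> Ck b k A f -> Ck b l A f.
Proof.
elim: k l f => [|k IH] [|l] f //= lk [df bf Df]; split => // v.
exact: IH.
Qed.

Lemma Ck_subset b k A (B : set V) f : A `<=` B ->
  Ck b k B f -> Ck b k A f.
Proof.
move=> AB; elim: k f => [|k IH] f [df bf Df]; split=> //.
- by move=> x /AB; exact: df.
- by move=> /bf[M fM]; exists M => x /AB; exact: fM.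
- by move=> x /AB; exact: df.
- by move=> /bf[M fM]; exists M => x /AB; exact: fM.
- by move=> v; exact/IH/Df.
Qed.

(** Derivatives at a point depend on nearby values, hence the openness of [A]. This is how a closed
    form of a derivative enters the inductions on [k]. *)
Lemma eq_Ck b k A f g : open A -> (forall x, A x -> f x = g x) ->
  Ck b k A f -> Ck b k A g.
Proof.
move=> oA.
have near_fg f' g' x : (forall x, A x -> f' x = g' x) -> A x ->
    \near x, f' x = g' x.
  by move=> fg Ax; near=> z; apply: fg; near: z; exact: open_nbhs_nbhs.
have base f' g' : (forall x, A x -> f' x = g' x) ->
    (forall x, A x -> differentiable f' x) /\
    (b -> exists M : R, forall x, A x -> `|f' x| <= M) ->
    (forall x, A x -> differentiable g' x) /\
    (b -> exists M : R, forall x, A x -> `|g' x| <= M).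
  move=> fg [df bf]; split=> [x Ax|/bf[M fM]].
    by apply: near_eq_differentiable (near_fg _ _ _ fg Ax) _; exact: df.
  by exists M => x Ax; rewrite -fg // fM.
elim: k f g => [|k IH] f g fg /= [df bf Df];
  have [//|dg bg] := base _ _ fg; split => // v.
apply: IH (Df v) => x Ax; apply: near_eq_derive; exact: near_fg.
Unshelve. all: by end_near. Qed.

Lemma Ck_cst b k A (c : R) : Ck b k A (fun=> c).
Proof.
elim: k c => [|k IH] c /=; split => //.
- by move=> _; exists `|c|.
- by move=> _; exists `|c|.
move=> v; rewrite (_ : 'D_v _ = fun=> 0); first exact: IH.
by apply/funext => x; exact: derive_cst.
Qed.

Lemma CkD b k A f g : open A -> Ck b k A f -> Ck b k A g ->
  Ck b k A (fun x => f x + g x).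
Proof.
move=> oA; elim: k f g => [|k IH] f g /= [df bf Df] [dg bg Dg].
- split=> // [x Ax|tb]; first by apply: differentiableD; [exact: df|exact: dg].
  have [[M fM] [N gN]] := (bf tb, bg tb); exists (M + N) => x Ax.
  by rewrite (le_trans (ler_normD _ _)) // lerD ?fM ?gN.
- split=> // [x Ax|tb|v].
  + by apply: differentiableD; [exact: df|exact: dg].
  + have [[M fM] [N gN]] := (bf tb, bg tb); exists (M + N) => x Ax.
    by rewrite (le_trans (ler_normD _ _)) // lerD ?fM ?gN.
  + apply: (eq_Ck oA) (IH _ _ (Df v) (Dg v)) => x Ax.
    by apply/esym/deriveD; apply: diff_derivable; [exact: df|exact: dg].
Qed.

Lemma CkM b k A f g : open A -> Ck b k A f -> Ck b k A g ->
  Ck b k A (fun x => f x * g x).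
Proof.
move=> oA.
have base f' g' : Ck b 0 A f' -> Ck b 0 A g' -> Ck b 0 A (fun x => f' x * g' x).
  move=> /= [df bf _] [dg bg _]; split=> // [x Ax|tb].
    by apply: differentiableM; [exact: df|exact: dg].
  have [[M fM] [N gN]] := (bf tb, bg tb); exists (M * N) => x Ax.
  by rewrite normrM ler_pM ?fM ?gN.
elim: k f g => [|k IH] f g Cf Cg; first exact: base.
have [df bf _] : Ck b 0 A (fun x => f x * g x).
  by apply: base; [exact: Ck_le Cf|exact: Ck_le Cg].
split => // v.
have [[dff _ Df] [dgg _ Dg]] := (Cf, Cg).
have Cf' : Ck b k A f by exact: Ck_le Cf.
have Cg' : Ck b k A g by exact: Ck_le Cg.
apply: (eq_Ck oA) (CkD oA (IH _ _ Cf' (Dg v)) (IH _ _ Cg' (Df v))) => x Ax.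
by apply/esym/deriveM; apply: diff_derivable; [exact: dff|exact: dgg].
Qed.

Lemma CkZ b k A f (c : R) : open A -> Ck b k A f -> Ck b k A (fun x => c * f x).
Proof. by move=> oA; apply: CkM => //; exact: Ck_cst. Qed.

Lemma CkN b k A f : open A -> Ck b k A f -> Ck b k A (fun x => - f x).
Proof.
move=> oA /(CkZ (-1) oA); apply: (eq_Ck oA) => x _.
by rewrite mulN1r.
Qed.

Lemma CkB b k A f g : open A -> Ck b k A f -> Ck b k A g ->
  Ck b k A (fun x => f x - g x).
Proof. by move=> oA Cf Cg; apply: CkD => //; exact: CkN. Qed.

Lemma Ck_sum b k A I (r : seq I) (P : pred I) (F : I -> V -> R^o) : open A ->
  (forall i, Ck b k A (F i)) -> Ck b k A (fun x => \sum_(i <- r | P i) F i x).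
Proof.
move=> oA CF; elim: r => [|i r IH].
  by apply: (eq_Ck oA) (Ck_cst b k A 0) => x _; rewrite big_nil.
have [Pi|Pi] := boolP (P i).
  apply: (eq_Ck oA) (CkD oA (CF i) IH) => x _.
  by rewrite big_cons Pi.
by apply: (eq_Ck oA) IH => x _; rewrite big_cons (negPf Pi).
Qed.

Lemma Ck_linear (b : bool) k A (f : {linear V -> R^o}) : continuous f ->
  (b -> exists M : R, forall x, A x -> `|f x| <= M) -> Ck b k A f.
Proof.
move=> fc bf; have df x : differentiable f x by exact: linear_differentiable.
case: k => [|k] /=; split => // v.
rewrite (_ : 'D_v f = fun=> f v); first exact: Ck_cst.
apply/funext => x; rewrite deriveE ?diff_lin //.
Qed.

(** The chain rule expresses a derivative of the composite through the two partial derivatives of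
    [f] composed with the same [g1], [g2], so the induction closes. *)
Lemma Ck_comp b k A (B : set R2) (f : R2 -> R^o) (g1 g2 : V -> R^o) :
  open A -> (forall x, A x -> B (g1 x, g2 x)) -> Ck b k B f ->
  Ck b k A g1 -> Ck b k A g2 -> Ck b k A (fun x => f (g1 x, g2 x)).
Proof.
move=> oA AB.
have dcomp (f' : R2 -> R^o) x : differentiable g1 x -> differentiable g2 x ->
    differentiable f' (g1 x, g2 x) ->
    differentiable (fun x => f' (g1 x, g2 x) : R^o) x /\
    forall v, 'D_v (fun x => f' (g1 x, g2 x) : R^o) x =
      'D_(1, 0) f' (g1 x, g2 x) * 'D_v g1 x +
      'D_(0, 1) f' (g1 x, g2 x) * 'D_v g2 x.
  move=> d1 d2 df.
  have d12 : differentiable (fun x => (g1 x, g2 x)) x.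
    exact: differentiable_pair.
  have dfg : differentiable (f' \o (fun x => (g1 x, g2 x))) x.
    exact: differentiable_comp.
  split=> // v.
  rewrite -[LHS]/('D_v (f' \o (fun x => (g1 x, g2 x))) x) deriveE //.
  rewrite diff_comp //= diff_pair //= -deriveE // derive_pairE //=.
  by rewrite -!deriveE // mulrC [X in _ + X]mulrC.
elim: k f => [|k IH] f /= [df bf Df] C1 C2;
  have [[d1 _ D1] [d2 _ D2]] := (C1, C2).
- split=> // [x Ax|/bf[M fM]]; last by exists M => x Ax; apply: fM; exact: AB.
  by apply: (dcomp _ _ _ _ _).1; [exact: d1|exact: d2|exact/df/AB].
- split=> // [x Ax|/bf[M fM]|v].
  + by apply: (dcomp _ _ _ _ _).1; [exact: d1|exact: d2|exact/df/AB].
  + by exists M => x Ax; apply: fM; exact: AB.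
  have C1' : Ck b k A g1 by exact: (@Ck_le b k.+1).
  have C2' : Ck b k A g2 by exact: (@Ck_le b k.+1).
  have K1 := IH _ (Df (1, 0)) C1' C2'.
  have K2 := IH _ (Df (0, 1)) C1' C2'.
  apply: (eq_Ck oA) (CkD oA (CkM oA K1 (D1 v)) (CkM oA K2 (D2 v))) => x Ax.
  rewrite (dcomp _ _ _ _ _).2 //; [exact: d1|exact: d2|exact/df/AB].
Qed.

(** [Ck] differentiates first in the innermost direction, which is the last one in the list of
    [iter_derive]; hence the recursion along [rcons]. *)
Lemma smooth_onP A f : smooth_on A f <-> forall k, Ck false k A f.
Proof.
split=> [+ k|Cf vs x Ax].
  elim: k f => [|k IH] f sf /=; split => //;
    try exact: (sf [::]).
  move=> v;  apply: IH => vs x Ax; have := sf (rcons vs v) x Ax.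
  by rewrite /iter_derive foldr_rcons.
elim/last_ind: vs f Cf => [|vs v IH] f Cf; first by have [+ _ _] := Cf 0; exact.
rewrite /iter_derive foldr_rcons; apply: IH => k.
by have [_ _ +] := Cf k.+1; exact.
Qed.

(** The derivatives of order at most [k] are differentiable, hence continuous, at the points of
    [K]. *)
Lemma Ck_compact k A K f : A `<=` K -> compact K -> Ck false k K f ->
  Ck true k A f.
Proof.
move=> AK cK.
have base f' : (forall x, K x -> differentiable f' x) ->
    (forall x, A x -> differentiable f' x) /\
    (true -> exists M : R, forall x, A x -> `|f' x| <= M).
  move=> df; split=> [x /AK|_]; first exact: df.
  have /compact_bounded[M [_ MP]] : compact (f' @` K).
    apply: continuous_compact => //; apply: continuous_in_subspaceT => x.
    by rewrite inE => /df/differentiable_continuous.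
  exists (M + 1) => x /AK Kx; apply: (MP (M + 1)); last by exists x.
  by rewrite ltrDl.
elim: k f => [|k IH] f /= [/base[df bf] _ Df]; split => // v.
exact: IH.
Qed.

End V.

(** The two difference quotients are equal before the limit is taken. *)
Lemma derive_affine (V V' W : normedModType R) (f : V -> W) (h : V' -> V)
    (l : V' -> V) (x v : V') :
  (forall t : R, h (t *: v + x) = t *: l v + h x) ->
  'D_v (f \o h) x = 'D_(l v) f (h x).
Proof.
move=> hE; rewrite /derive; congr (lim _).
suff -> : (fun t : R => t^-1 *: (((f \o h) \o shift x) (t *: v) - (f \o h) x)) =
  (fun t : R => t^-1 *: ((f \o shift (h x)) (t *: l v) - f (h x))) by [].
by apply/funext => t /=; rewrite hE.
Qed.

End Ck_functions.

(** * Averages of dilated functions *)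

Section plane.
Variable R : realType.
Local Notation R2 := (R^o * R^o)%type.

Lemma cont_add (T : topologicalType) (f g : T -> R) :
  continuous f -> continuous g -> continuous (fun x => f x + g x).
Proof. by move=> cf cg x; apply: (@cvgD _ R^o); [exact: cf|exact: cg]. Qed.

Lemma cont_mul (T : topologicalType) (f g : T -> R) :
  continuous f -> continuous g -> continuous (fun x => f x * g x).
Proof. by move=> cf cg x; apply: cvgM; [exact: cf|exact: cg]. Qed.

Lemma is_diff_pair_eps (f : R2 -> R^o) (p : R2) (a1 a2 : R) :
  (forall e : R, 0 < e -> exists2 d : R, 0 < d & forall h : R2,
    `|h.1| < d -> `|h.2| < d ->
    `|f (h + p) - f p - (h.1 * a1 + h.2 * a2)| <= e * (`|h.1| + `|h.2|)) ->
  differentiable f p /\ forall v, 'D_v f p = v.1 * a1 + v.2 * a2.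
Proof.
pose l (h : R2) : R^o := h.1 * a1 + h.2 * a2.
have linl : linear l.
  by move=> c x y; rewrite /l /= /GRing.scale /=; ring.
have lc : continuous l.
  apply: cont_add; apply: cont_mul => x;
    [exact: cvg_fst|exact: cvg_cst|exact: cvg_snd|exact: cvg_cst].
pose lL := GRing.isLinear.Build _ _ _ _ l linl.
pose L : {linear R2 -> R^o} := HB.pack l lL.
move=> fP; have [|df dE] := @is_diff_eps R R2 R^o f L p lc.
  (* The norm of a pair is the maximum, and [|h.1| + |h.2|] is at most twice the maximum. *)
  move=> e e0; have [d d0 dP] := fP (e / 2) (divr_gt0 e0 (ltr0n _ 2)).
  exists (ball (0 : R^o) d, ball (0 : R^o) d).
    by split; exact: nbhsx_ballx.
  move=> [u v] [/=]; rewrite -!ball_normE /= !sub0r !normrN => ud vd.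
  rewrite (le_trans (dP (u, v) ud vd)) //= -mulrA ler_pM2l // prod_normE /=.
  rewrite -[leRHS]/(Num.max `|u| `|v|); have := le_max `|u| `|u| `|v|.
  by have := le_max `|v| `|u| `|v|; rewrite !lexx orbT /= => *; lra.
by split=> // v; rewrite deriveE // dE.
Qed.

Lemma is_derive_line (P : R2 -> R^o) (x h : R2) (t : R) :
  differentiable P (t *: h + x) ->
  is_derive (t : R^o) 1 (fun t : R^o => P (t *: h + x)) ('D_h P (t *: h + x)).
Proof.
move=> dP; have dl : differentiable (fun t : R^o => t *: h + x) t.
  by apply: differentiableD => //; exact: differentiableZl.
split.
  by apply/diff_derivable; apply: (differentiable_comp dl).
rewrite -[LHS]/('D_1 (P \o (fun t : R^o => t *: h + x)) (t : R^o)).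
rewrite (@derive_affine R R2 R^o R^o P _ (fun s : R^o => s *: h)) ?scale1r //.
by move=> u; rewrite -[u%:A]/(u * 1) mulr1 scalerDl addrA.
Qed.

(** In [taylor2] the [xij] are second derivatives and [c] is the point given by the first mean value
    theorem. *)
Lemma quadratic_form_le (a b x11 x12 x21 x22 m11 m12 m21 m22 c : R) :
  `|x11| <= m11 -> `|x12| <= m12 -> `|x21| <= m21 -> `|x22| <= m22 ->
  0 <= c <= 1 ->
  `|(a * (a * x11 + b * x21) + b * (a * x12 + b * x22)) * c| <=
    (`|m11| + `|m12| + `|m21| + `|m22|) * (`|a| + `|b|) ^+ 2.
Proof.
move=> h11 h12 h21 h22 /andP[c0 c1].
set M := _ + `|m22|.
have n11 := le_trans h11 (ler_norm _); have n12 := le_trans h12 (ler_norm _).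
have n21 := le_trans h21 (ler_norm _); have n22 := le_trans h22 (ler_norm _).
move: (normr_ge0 m11) (normr_ge0 m12) (normr_ge0 m21) (normr_ge0 m22) => *.
have M1 : `|x11| <= M by rewrite /M; lra.
have M2 : `|x12| <= M by rewrite /M; lra.
have M3 : `|x21| <= M by rewrite /M; lra.
have M4 : `|x22| <= M by rewrite /M; lra.
have M0 : 0 <= M by rewrite (le_trans _ M1).
rewrite normrM (ger0_norm c0).
apply: (@le_trans _ _ (M * (`|a| + `|b|) ^+ 2 * 1)); last by rewrite mulr1.
apply: ler_pM => //.
rewrite (le_trans (ler_normD _ _)) // !normrM.
have bnd (X Y : R) : `|X| <= M -> `|Y| <= M ->
    `|a * X + b * Y| <= (`|a| + `|b|) * M.
  move=> XM YM; rewrite (le_trans (ler_normD _ _)) // !normrM mulrDl.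
  by apply: lerD; apply: ler_wpM2l.
apply: (@le_trans _ _ (`|a| * ((`|a| + `|b|) * M) + `|b| * ((`|a| + `|b|) * M))).
  by apply: lerD; apply: ler_wpM2l => //; exact: bnd.
by rewrite le_eqVlt; apply/orP; left; apply/eqP; ring.
Qed.

(** The mean value theorem is applied along the segment, then to the derivative so obtained. A
    single [M] for all [x] and [h] is the point: [smear_diff] uses it at all the dilated points
    [(p.1, l * p.2)] at once. *)
Lemma taylor2 (P : R2 -> R^o) (B : set R2) : Ck true 2 B P ->
  exists2 M : R, 0 <= M & forall x h : R2,
    (forall t : R, 0 <= t <= 1 -> B (t *: h + x)) ->
    `|P (h + x) - P x - (h.1 * 'D_(1, 0) P x + h.2 * 'D_(0, 1) P x)|
      <= M * (`|h.1| + `|h.2|) ^+ 2.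
Proof.
move=> [dP _ DP].
have bD i j : exists M : R, forall x, B x -> `|'D_i ('D_j P) x| <= M.
  by have [_ _ /(_ i)[_ /(_ isT)]] := DP j.
have [M11 b11] := bD (1, 0) (1, 0); have [M12 b12] := bD (1, 0) (0, 1).
have [M21 b21] := bD (0, 1) (1, 0); have [M22 b22] := bD (0, 1) (0, 1).
exists (`|M11| + `|M12| + `|M21| + `|M22|); first by rewrite !addr_ge0.
move=> x h Bxh.
pose D1 := 'D_(1, 0) P; pose D2 := 'D_(0, 1) P.
pose f1 t := h.1 * D1 (t *: h + x) + h.2 * D2 (t *: h + x).
have Bin (t : R) : t \in `]0, 1[ -> B (t *: h + x).
  by rewrite in_itv /= => /andP[t0 t1]; apply: Bxh; rewrite !ltW.
have d0 (t : R) : 0 <= t <= 1 ->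
    is_derive (t : R^o) 1 (fun t : R^o => P (t *: h + x)) (f1 t).
  move=> /Bxh Bt; rewrite /f1 -derive_pairE; last exact: dP.
  by apply: is_derive_line; exact: dP.
pose f2 t := h.1 * ('D_h D1 (t *: h + x)) + h.2 * ('D_h D2 (t *: h + x)).
have d1 (t : R) : 0 <= t <= 1 -> is_derive (t : R^o) 1 (f1 : R^o -> R^o) (f2 t).
  move=> /Bxh Bt; have [dD1 _ _] := DP (1, 0); have [dD2 _ _] := DP (0, 1).
  apply: is_deriveD; apply: is_deriveZ; apply: is_derive_line;
    [exact: dD1|exact: dD2].
have cont (f g : R -> R) (c : R) : c <= 1 ->
    (forall t : R, 0 <= t <= 1 -> is_derive (t : R^o) 1 (f : R^o -> R^o) (g t)) ->
    {within `[0, c], continuous f}.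
  move=> c1 df; apply: continuous_in_subspaceT => t; rewrite inE /= in_itv /=.
  move=> /andP[t0 tc]; have /df[dft _] : 0 <= t <= 1.
    by rewrite t0 (le_trans tc).
  by apply: differentiable_continuous; exact/derivable1_diffP.
have sub01 (t : R) : t \in `]0, 1[ -> 0 <= t <= 1.
  by rewrite in_itv /= => /andP[t0 t1]; rewrite !ltW.
have [c c01] := @MVT R (fun t => P (t *: h + x)) f1 0 1 ltr01
  (fun t t01 => d0 t (sub01 t t01)) (cont _ _ _ (lexx 1) d0).
rewrite scale1r scale0r add0r subr0 mulr1 => ->.
move: c01; rewrite in_itv /= => /andP[c0 c1].
have sub0c (t : R) : t \in `]0, c[ -> 0 <= t <= 1.
  rewrite in_itv /= => /andP[t0 tc]; rewrite ltW //=.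
  by rewrite (le_trans (ltW tc)) // ltW.
have [c' c'0c] := @MVT R f1 f2 0 c c0
  (fun t t01 => d1 t (sub0c t t01)) (cont _ _ _ (ltW c1) d1).
rewrite {2}/f1 scale0r add0r => ->; rewrite subr0.
have /Bxh Bc' := sub0c _ c'0c.
have dD (v : R2) : differentiable ('D_v P) (c' *: h + x).
  by have [+ _ _] := DP v; exact.
pose q : R2 := c' *: h + x.
have E (v : R2) : 'D_h ('D_v P) q =
    h.1 * 'D_(1, 0) ('D_v P) q + h.2 * 'D_(0, 1) ('D_v P) q.
  exact/derive_pairE/dD.
rewrite /f2 /D1 /D2 -/q !E; apply: quadratic_form_le;
  [exact: b11|exact: b12|exact: b21|exact: b22|by rewrite !ltW].
Qed.

Definition polybounded (m : nat) (M : R) (phi : R -> R) :=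
  forall l, `|phi l| <= M * (1 + l ^+ 2) ^+ m.

Definition slowly_growing (phi : R -> R) :=
  continuous phi /\ exists m M, polybounded m M phi.

(* Covers both [int_0^1 phi] and the series [sum_k b_k phi (2 ^ k)]. *)
Record averaging (L : (R -> R) -> R) : Prop := Averaging {
  averagingD : forall phi psi c, slowly_growing phi -> slowly_growing psi ->
    L (fun l => phi l + c * psi l) = L phi + c * L psi;
  averaging_le : forall m, exists2 C, 0 <= C & forall phi M,
    continuous phi -> polybounded m M phi -> `|L phi| <= C * M }.

(** Unbounded in the second variable, hence stable under the dilations [(s, t) -> (s, l * t)]. *)
Definition strip (a d : R) : set R2 := [set p | `|p.1 - a| < d].

Lemma open_strip a d : open (strip a d).
Proof.
have -> : strip a d = (fun p : R2 => p.1 - a) @^-1` ball (0 : R) d.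
  by apply/seteqP; split=> p; rewrite /strip /ball /= sub0r normrN.
apply: open_comp; last exact: ball_open.
move=> p _; apply: (@continuousB _ R^o); [exact: cvg_fst|exact: cvg_cst].
Qed.

Lemma slowly_growingD phi psi (c : R) : slowly_growing phi ->
  slowly_growing psi -> slowly_growing (fun l => phi l + c * psi l).
Proof.
move=> [cphi [m [M phiM]]] [cpsi [m' [M' psiM]]]; split.
  by apply: cont_add => //; apply: cont_mul => // x; exact: cvg_cst.
exists (m + m')%N, (`|M| + `|c| * `|M'|) => l.
have g1 (k : nat) : 1 <= (1 + l ^+ 2) ^+ k.
  by rewrite exprn_ege1 // lerDl sqr_ge0.
have g0 (k : nat) : 0 <= (1 + l ^+ 2) ^+ k by rewrite (le_trans _ (g1 k)).
rewrite (le_trans (ler_normD _ _)) // normrM mulrDl exprD; apply: lerD.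
  rewrite (le_trans (phiM l)) // mulrA.
  rewrite (le_trans (ler_wpM2r (g0 m) (ler_norm _))) //.
  by rewrite ler_peMr // mulr_ge0.
rewrite -mulrA ler_wpM2l // (le_trans (psiM l)) //.
rewrite (le_trans (ler_wpM2r (g0 m') (ler_norm _))) // mulrCA.
by rewrite ler_peMl // mulr_ge0.
Qed.

Section smear.
Variables (L : (R -> R) -> R) (a d : R).
Hypothesis avgL : averaging L.

(* Differentiating in the second variable multiplies the integrand by [l], hence
   the family indexed by [j], which is stable under derivation. *)
Definition smear (j : nat) (P : R2 -> R^o) : R2 -> R^o :=
  fun p => L (fun l => l ^+ j * P (p.1, l * p.2)).

Lemma slowly_growing_slice j (P : R2 -> R^o) M (p : R2) : strip a d p ->
  (forall x, strip a d x -> differentiable P x) ->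
  (forall x, strip a d x -> `|P x| <= M) ->
  continuous (fun l : R => l ^+ j * P (p.1, l * p.2) : R) /\
  polybounded j M (fun l => l ^+ j * P (p.1, l * p.2)).
Proof.
move=> sp dP PM; split.
  apply: cont_mul; first exact: exprn_continuous.
  move=> l; apply: (@continuous_comp _ _ _ (fun l : R => (p.1, l * p.2) : R2) P).
    apply: differentiable_continuous.
    by apply: (@differentiable_pair R R^o R^o R^o (fun=> p.1) (fun l => l * p.2)).
  by apply: differentiable_continuous; exact: dP.
move=> l; rewrite normrM mulrC; apply: ler_pM => //; first exact: PM.
rewrite normrX lerXn2r ?nnegrE // ?addr_ge0 ?sqr_ge0 //.
rewrite -[X in _ + X]real_normK ?num_real //.
have := normr_ge0 l; set u := `|l| => u0; clear -u0; nra.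
Qed.

(** Convexity of the strip, which provides the segments required by [taylor2]. *)
Lemma ltr_norm_conv (t u v e : R) : 0 <= t <= 1 -> `|u + v| < e -> `|v| < e ->
  `|t * u + v| < e.
Proof.
move=> /andP[t0 t1] uv ve.
have -> : t * u + v = t * (u + v) + (1 - t) * v by ring.
have me : Num.max `|u + v| `|v| < e by rewrite gt_max uv.
apply: le_lt_trans me; rewrite (le_trans (ler_normD _ _)) // !normrM.
rewrite ger0_norm // (@ger0_norm _ (1 - t)) ?subr_ge0 //.
set m := Num.max _ _; have u_m : `|u + v| <= m by rewrite le_max lexx.
have v_m : `|v| <= m by rewrite le_max lexx orbT.
by clear -t0 t1 u_m v_m; nra.
Qed.

(** The right-hand side has the nested shape [phi + c * psi] to which [averagingD] applies. *)
Lemma distr_remainder (u l h1 h2 x y z w : R) :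
  u * (x - y - (h1 * z + l * h2 * w)) =
  u * x + -1 * (u * y) + - h1 * (u * z) + - h2 * (l * u * w).
Proof. by ring. Qed.

(** Differentiation under [L] by linearity and growth alone: the first order remainder of
    [smear j P] is [L] of the Taylor remainder of [P], which is quadratic in [h] and, with the
    factor [l ^+ j], of growth [(1 + l ^+ 2) ^+ j.+1]. *)
Lemma smear_diff j P (p : R2) : Ck true 2 (strip a d) P -> strip a d p ->
  differentiable (smear j P) p /\
  forall v, 'D_v (smear j P) p =
    v.1 * smear j ('D_(1, 0) P) p + v.2 * smear j.+1 ('D_(0, 1) P) p.
Proof.
move=> CP sp; apply: is_diff_pair_eps => e e0.
have [M M0 MP] := taylor2 CP.
have [C C0 CL] := averaging_le avgL j.+1.
pose K := C * (2 * M).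
have K0 : 0 <= K by rewrite !mulr_ge0.
have sg i Q q : Ck true 0 (strip a d) Q -> strip a d q ->
    slowly_growing (fun l => l ^+ i * Q (q.1, l * q.2)).
  move=> [dQ /(_ isT)[N QN] _] sq.
  have [cQ bQ] := slowly_growing_slice i sq dQ QN.
  by split=> //; exists i, N.
have [_ _ DP] := CP.
have CP0 : Ck true 0 (strip a d) P by exact: Ck_le CP.
have CD v : Ck true 0 (strip a d) ('D_v P) by exact: (@Ck_le R _ true 1 0).
have eK : 0 < e / (2 * (K + 1)) by rewrite divr_gt0 // mulr_gt0 // ltr_wpDl.
have dp : 0 < d - `|p.1 - a| by rewrite subr_gt0.
(* The first bound turns the estimate [K * N * N] into [e * N], the [+ 1] covering [K = 0]; the
   second keeps [h + p] in the strip. *)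
exists (Num.min (e / (2 * (K + 1))) (d - `|p.1 - a|)).
  by rewrite lt_min eK.
move=> h; rewrite !lt_min => /andP[h1 hs] /andP[h2 _].
have sph : strip a d (h + p).
  rewrite /strip /= -addrA (le_lt_trans (ler_normD _ _)) //.
  by rewrite -ltrBrDr.
set N := `|h.1| + `|h.2|.
have N0 : 0 <= N by rewrite addr_ge0.
have hsmall : N <= e / (K + 1).
  move: h1 h2; rewrite invfM [_^-1 * _]mulrC mulrA /N => h1 h2; lra.
pose rem (l : R) : R := P (h.1 + p.1, l * (h.2 + p.2)) - P (p.1, l * p.2)
  - (h.1 * 'D_(1, 0) P (p.1, l * p.2) + (l * h.2) * 'D_(0, 1) P (p.1, l * p.2)).
have s1 := sg j _ _ CP0 sph; have s2 := sg j _ _ CP0 sp.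
have s3 := sg j _ _ (CD (1, 0)) sp; have s4 := sg j.+1 _ _ (CD (0, 1)) sp.
have s12 := slowly_growingD (-1) s1 s2.
have s123 := slowly_growingD (- h.1) s12 s3.
have remf : (fun l => l ^+ j * rem l) = (fun l =>
    (((l ^+ j * P ((h + p).1, l * (h + p).2)) + (-1) * (l ^+ j * P (p.1, l * p.2))) +
     (- h.1) * (l ^+ j * 'D_(1, 0) P (p.1, l * p.2))) +
     (- h.2) * (l ^+ j.+1 * 'D_(0, 1) P (p.1, l * p.2))).
  by apply/funext => l; rewrite /rem exprS; exact: distr_remainder.
have remE : smear j P (h + p) - smear j P p
   - (h.1 * smear j ('D_(1, 0) P) p + h.2 * smear j.+1 ('D_(0, 1) P) p)
   = L (fun l => l ^+ j * rem l).
  rewrite remf !(averagingD avgL) // opprD !mulNr mul1r addrA.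
  by [].
have cont_rem : continuous (fun l : R => l ^+ j * rem l).
  by rewrite remf; have [] := slowly_growingD (- h.2) s123 s4.
have bnd_rem : polybounded j.+1 (2 * M * N ^+ 2) (fun l => l ^+ j * rem l).
  move=> l; rewrite normrM.
  have remM : `|rem l| <= M * (`|h.1| + `|l * h.2|) ^+ 2.
    have := MP (p.1, l * p.2) (h.1, l * h.2).
    rewrite /rem /= mulrDr; apply => t /andP[t0 t1].
    move: sph sp; rewrite /strip /= -!addrA /GRing.scale /= => sph sp.
    by apply: ltr_norm_conv => //; rewrite t0.
  have h1' : `|h.1| <= N by rewrite lerDl.
  have h2' : `|h.2| <= N by rewrite lerDr.
  have h0 : 0 <= `|h.1| + `|l * h.2| by rewrite addr_ge0.
  have lh : `|h.1| + `|l * h.2| <= (1 + `|l|) * N.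
    by rewrite normrM mulrDl mul1r lerD // ler_wpM2l.
  have l2 : `|l| ^+ 2 = l ^+ 2 by rewrite real_normK ?num_real.
  have sq : (`|h.1| + `|l * h.2|) ^+ 2 <= 2 * N ^+ 2 * (1 + l ^+ 2).
    apply: (@le_trans _ _ (((1 + `|l|) * N) ^+ 2)).
      by rewrite lerXn2r // ?nnegrE // (le_trans h0).
    by rewrite -l2 -subr_ge0 (_ : _ - _ = (N * (1 - `|l|)) ^+ 2) ?sqr_ge0 //; ring.
  have lj : `|l ^+ j| <= (1 + l ^+ 2) ^+ j.
    rewrite normrX lerXn2r ?nnegrE // ?addr_ge0 ?sqr_ge0 // -l2.
    by have := normr_ge0 l; set u := `|l| => u0; clear -u0; nra.
  have remM2 : `|rem l| <= 2 * M * N ^+ 2 * (1 + l ^+ 2).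
    apply: (le_trans remM); rewrite [2 * M]mulrC -2!mulrA.
    by apply: ler_wpM2l => //; rewrite mulrA.
  rewrite [leRHS](_ : _ = (1 + l ^+ 2) ^+ j * (2 * M * N ^+ 2 * (1 + l ^+ 2))).
    exact: ler_pM.
  by rewrite [in RHS]mulrCA [_ ^+ j.+1]exprSr.
rewrite remE (le_trans (CL _ _ cont_rem bnd_rem)) //.
have K1 : 0 < K + 1 by rewrite ltr_wpDl.
have -> : C * (2 * M * N ^+ 2) = K * N * N by rewrite /K; ring.
rewrite ler_wpM2r // (le_trans (ler_wpM2l K0 hsmall)) // mulrCA ler_piMr ?(ltW e0) //.
by rewrite ler_pdivrMr // mul1r lerDl.
Qed.

Lemma smear_Ck j k P : (forall k, Ck true k (strip a d) P) ->
  Ck true k (strip a d) (smear j P).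
Proof.
elim: k j P => [|k IH] j P CP.
  split=> // [x sx|_]; first by have [] := smear_diff j (CP 2) sx.
  have [dP /(_ isT)[M PM] _] := CP 0; have [C C0 CL] := averaging_le avgL j.
  exists (C * M) => p sp.
  by have [cP bP] := slowly_growing_slice j sp dP PM; exact: CL.
have [d0 b0 _] : Ck true 0 (strip a d) (smear j P).
  split=> // [x sx|_]; first by have [] := smear_diff j (CP 2) sx.
  have [dP /(_ isT)[M PM] _] := CP 0; have [C C0 CL] := averaging_le avgL j.
  exists (C * M) => p sp.
  by have [cP bP] := slowly_growing_slice j sp dP PM; exact: CL.
split=> // v; have os := @open_strip a d.
have CD v' l : Ck true l (strip a d) ('D_v' P) by have [_ _] := CP l.+1; exact.
apply: (eq_Ck os) (CkD os (CkZ v.1 os (IH j _ (CD (1, 0))))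
  (CkZ v.2 os (IH j.+1 _ (CD (0, 1))))) => p sp.
by have [_ ->] := smear_diff j (CP 2) sp.
Qed.

End smear.
End plane.

(** * The weights of Seeley's extension operator *)

Section seeley_weights.
Variable R : realType.

Lemma series_geometric_le (f : R^nat) (C q : R) : 0 <= q -> q < 1 ->
  (forall k, `|f k| <= C * q ^+ k) ->
  cvgn (series f) /\ `|limn (series f)| <= C / (1 - q).
Proof.
move=> q0 q1 fC; have qn : `|q| < 1 by rewrite ger0_norm.
have gc := @cvg_geometric_series R C q qn.
have nc : cvgn [normed series f].
  apply: (@series_le_cvg R _ (geometric C q)) => //.
  - by move=> k; exact: normr_ge0.
  - by move=> k /=; apply: le_trans (fC k).
  - exact: cvgP gc.
split; first exact: normed_cvg.
rewrite (le_trans (lim_series_norm nc)) // -(cvg_lim _ gc) //.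
apply: lim_series_le => //; exact: cvgP gc.
Qed.

(* The recursion makes [E z = sum_k a_k z ^ k] satisfy [E (4 z) = (1 - 4 z) E z],
   so that [E] vanishes at all the [4 ^ j]; then [h z = sum_k a_k / (4 ^ k + 1)
   z ^ k] satisfies [h z + h (4 z) = E z], whence [h (4 ^ j) = (-1) ^ j h 1]. *)
Fixpoint seeley_coef (k : nat) : R :=
  if k is k'.+1 then - 4 * seeley_coef k' / (4 ^+ k'.+1 - 1) else 1.

Lemma exp4S_gt1 k : 1 < (4 : R) ^+ k.+1.
Proof. by rewrite exprn_egt1 //; lra. Qed.

Lemma seeley_coefS k :
  `|seeley_coef k.+1| = `|seeley_coef k| * (4 / (4 ^+ k.+1 - 1)).
Proof.
have e1 := exp4S_gt1 k.
rewrite /= normrM normrM normrN (ger0_norm (ler0n _ 4)).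
rewrite [X in _ * X]gtr0_norm ?invr_gt0 ?subr_gt0 //.
by rewrite [4 * _]mulrC mulrA.
Qed.

(** The value [4 / 3] is attained at index 1; from there on the ratios [4 / (4 ^ k - 1)] are below
    1. *)
Lemma seeley_coef_le k : `|seeley_coef k| <= 4 / 3.
Proof.
case: k => [|k]; first by rewrite /= normr1; lra.
elim: k => [|k IH].
  rewrite seeley_coefS /= normr1 expr1 mul1r.
  by have -> : 4 - 1 = 3 :> R by ring.
rewrite seeley_coefS (le_trans _ IH) // ler_piMr //.
have e2 : 16 <= (4 : R) ^+ k.+2.
  rewrite !exprS; have : 1 <= (4 : R) ^+ k by rewrite exprn_ege1 //; lra.
  by move: (4 ^+ k) => u; lra.
by rewrite ler_pdivrMr ?mul1r; lra.
Qed.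

(** The terms [c k] have ratio [8 x / (4 ^ k.+1 - 1)], eventually at most 1, so they are bounded by
    the sum of the first ones. Working with [2 * x] instead of [x] leaves the geometric factor
    [2^-1 ^+ k]. *)
Lemma seeley_coef_decay (x : R) : 0 < x ->
  exists2 C, 0 <= C & forall k, `|seeley_coef k| * x ^+ k <= C * 2^-1 ^+ k.
Proof.
move=> x0; pose c k := `|seeley_coef k| * (2 * x) ^+ k.
have c0 k : 0 <= c k by rewrite mulr_ge0 // exprn_ge0 // mulr_ge0 // ltW.
have cS k : c k.+1 = c k * (8 * x / (4 ^+ k.+1 - 1)).
  rewrite /c seeley_coefS [(2 * x) ^+ k.+1]exprS; set e := (_ - 1)^-1; ring.
have [N NP] : exists N, forall k, (N <= k)%N -> 8 * x <= 4 ^+ k.+1 - 1.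
  exists (Num.bound (8 * x + 1)) => k Nk; rewrite lerBrDr.
  have x1 : 0 <= 8 * x + 1 by lra.
  rewrite (le_trans (ltW (archi_boundP x1))) // (le_trans _ (ler_weXn2l _ (leqW Nk))) //; last by lra.
  by rewrite -natrX ler_nat ltnW // ltn_expl.
exists (\sum_(i < N.+1) c i); first by rewrite sumr_ge0.
have cM k : c k <= \sum_(i < N.+1) c i.
  have small j : (j <= N)%N -> c j <= \sum_(i < N.+1) c i.
    move=> jN; rewrite (bigD1 (inord j)) //= inordK // lerDl.
    by rewrite sumr_ge0.
  have [/small //|Nk] := leqP k N.
  rewrite (le_trans _ (small N _)) // -(subnKC (ltnW Nk)).
  elim: (k - N)%N => [|m IH]; first by rewrite addn0.
  rewrite addnS cS (le_trans _ IH) // ler_piMr // ler_pdivrMr ?mul1r.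
    by apply: NP; rewrite leq_addr.
  by rewrite subr_gt0 exp4S_gt1.
move=> k; rewrite -ler_pdivrMr ?exprn_gt0 ?invr_gt0 // -exprVn invrK.
by rewrite -mulrA -exprMn mulrC [x * 2]mulrC mulrC (le_trans _ (cM k)) // /c.
Qed.

(** The function [E]: it is Euler's product of the [1 - z / 4 ^ i] over [i >= 0], expanded in powers
    of [z]. *)
Definition seeley_exp (z : R) : R := limn (series (fun k => seeley_coef k * z ^+ k)).

(** The function [h] attached to [E]. *)
Definition seeley_half (z : R) : R :=
  limn (series (fun k => seeley_coef k / (4 ^+ k + 1) * z ^+ k)).

Lemma cvg_seeley_exp z : 0 < z ->
  series (fun k => seeley_coef k * z ^+ k) @ \oo --> seeley_exp z.
Proof.
move=> z0; have [C C0 CP] := seeley_coef_decay z0.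
have [] := @series_geometric_le (fun k => seeley_coef k * z ^+ k) C 2^-1; try lra.
  by move=> k; rewrite normrM normrX (gtr0_norm z0).
by [].
Qed.

Lemma exp4_ge0 k : 0 <= (4 : R) ^+ k. Proof. by rewrite exprn_ge0. Qed.

Lemma cvg_seeley_half z : 0 < z ->
  series (fun k => seeley_coef k / (4 ^+ k + 1) * z ^+ k) @ \oo --> seeley_half z.
Proof.
move=> z0; have [C C0 CP] := seeley_coef_decay z0.
have [] := @series_geometric_le
  (fun k => seeley_coef k / (4 ^+ k + 1) * z ^+ k) C 2^-1; try lra.
  move=> k; rewrite !normrM normrX (gtr0_norm z0) (le_trans _ (CP k)) //.
  rewrite ler_wpM2r ?exprn_ge0 ?(ltW z0) // ler_piMr // ger0_norm.
    by rewrite invf_le1 ?ler_wpDl ?exp4_ge0 // ltr_wpDl ?exp4_ge0.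
  by rewrite invr_ge0 addr_ge0 ?exp4_ge0.
by [].
Qed.

Lemma seeley_expM4 z : 0 < z -> seeley_exp (4 * z) = (1 - 4 * z) * seeley_exp z.
Proof.
move=> z0; have z40 : 0 < 4 * z by rewrite mulr_gt0.
have c1 := cvg_seeley_exp z0; have c4 := cvg_seeley_exp z40.
suff : (fun n => series (fun k => seeley_coef k * (4 * z) ^+ k) n.+1) @ \oo -->
    seeley_exp z - 4 * z * seeley_exp z.
  rewrite cvg_shiftS => c4'; rewrite -(cvg_unique _ c4' c4) //.
  by rewrite mulrBl mul1r.
(* The functional equation already holds between partial sums, one degree apart. *)
have -> : (fun n => series (fun k => seeley_coef k * (4 * z) ^+ k) n.+1) =
    (fun n => series (fun k => seeley_coef k * z ^+ k) n.+1 -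
              4 * z * series (fun k => seeley_coef k * z ^+ k) n).
  apply/funext; elim=> [|n IH].
    by rewrite /series /= !big_nat1 big_geq // !expr0 mulr0 subr0.
  move: IH; rewrite /series /= => IH.
  rewrite big_nat_recr //= IH [in RHS]big_nat_recr //=.
  rewrite [X in _ = _ - _ * X]big_nat_recr //=.
  have := exp4S_gt1 n; rewrite !exprMn => e1.
  set X := \sum_(0 <= i < n) _; set c := seeley_coef n.
  rewrite big_nat_recr //= -/X -/c exprS.
  have e0 : (4 : R) * 4 ^+ n - 1 != 0 by rewrite -exprS; lra.
  by rewrite [in z ^+ n.+1]exprS; field.
apply: cvgB; first by rewrite cvg_shiftS.
by apply: cvgM => //; exact: cvg_cst.
Qed.

(** The factor [1 - 4 z] vanishes at [z = 4^-1], which gives the zero at 1; the functional equation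
    carries it to the other powers of 4. *)
Lemma seeley_exp0 j : seeley_exp (4 ^+ j) = 0.
Proof.
elim: j => [|j IH]; last by rewrite exprS seeley_expM4 ?exprn_gt0 // IH mulr0.
rewrite expr0 -(@mulfV _ (4 : R)) // seeley_expM4 ?invr_gt0 //.
by rewrite mulfV // subrr mul0r.
Qed.

Lemma seeley_halfM4 z : 0 < z ->
  seeley_half z + seeley_half (4 * z) = seeley_exp z.
Proof.
move=> z0; have z40 : 0 < 4 * z by rewrite mulr_gt0.
have c : (fun n => series (fun k => seeley_coef k / (4 ^+ k + 1) * z ^+ k) n +
      series (fun k => seeley_coef k / (4 ^+ k + 1) * (4 * z) ^+ k) n) @ \oo -->
    seeley_half z + seeley_half (4 * z).
  by apply: cvgD; exact: cvg_seeley_half.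
apply: (cvg_unique _ c) => //; have := cvg_seeley_exp z0.
apply: cvg_trans; apply/near_eq_cvg/nearW => n.
rewrite /series /= -big_split /=; apply: eq_bigr => k _.
have e0 : (4 : R) ^+ k + 1 != 0 by rewrite gt_eqF // ltr_wpDl ?exp4_ge0.
by rewrite exprMn; field.
Qed.

(** The first term is [1 / 2], and the later ones, at most [4 / 3 * 4 ^ - k] at index [k], add up to
    at most [4 / 9]. Positivity allows the normalization of the weights by [h 1]. *)
Lemma seeley_half1_gt0 : 0 < seeley_half 1.
Proof.
pose f k : R := seeley_coef k / (4 ^+ k + 1) * 1 ^+ k.
pose g k := f k.+1.
have [gc gle] : cvgn (series g) /\ `|limn (series g)| <= 3^-1 / (1 - 4^-1).
  apply: series_geometric_le; try lra.
  move=> k; rewrite /g /f expr1n mulr1 normrM.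
  have e0 : 0 < (4 : R) ^+ k by rewrite exprn_gt0.
  have -> : 3^-1 * 4^-1 ^+ k = 4 / 3 * (4 ^+ k.+1)^-1 :> R.
    by rewrite exprVn exprS; field; rewrite gt_eqF.
  apply: ler_pM => //; first exact: seeley_coef_le.
  rewrite ger0_norm ?invr_ge0 ?addr_ge0 ?exp4_ge0 //.
  by rewrite lef_pV2 ?posrE ?lerDl // ?exprn_gt0 // addr_gt0 // exprn_gt0.
have cf : series f @ \oo --> f 0%N + limn (series g).
  rewrite -cvg_shiftS.
  have -> : (fun n => series f n.+1) = (fun n => f 0%N + series g n).
    by apply/funext => n; rewrite /series /= big_nat_recl.
  by apply: cvgD => //; exact: cvg_cst.
have -> : seeley_half 1 = f 0%N + limn (series g).
  exact: (cvg_unique _ (cvg_seeley_half ltr01) cf).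
have -> : f 0%N = 1 / 2 by rewrite /f /= expr0 expr1n mulr1.
have e : 3^-1 / (1 - 4^-1) = 4 / 9 :> R by field.
by move: gle; rewrite e; move: (limn _) => u; rewrite ler_norml => /andP[g1 g2]; lra.
Qed.

Lemma seeley_half4 j : seeley_half (4 ^+ j) = (-1) ^+ j * seeley_half 1.
Proof.
elim: j => [|j IH]; first by rewrite !expr0 mul1r.
have e0 : 0 < (4 : R) ^+ j by rewrite exprn_gt0.
have := seeley_halfM4 e0; rewrite seeley_exp0 -exprS => /eqP.
by rewrite addr_eq0 => /eqP/(congr1 -%R); rewrite opprK => <-; rewrite IH exprS mulN1r mulNr.
Qed.

(** The [b_k]: division by [h 1] turns [h (4 ^ j) = (-1) ^ j h 1] into the moment conditions. *)
Definition seeley_weight k : R := seeley_coef k / (4 ^+ k + 1) / seeley_half 1.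

Lemma seeley_weight_le k : `|seeley_weight k| <= `|seeley_coef k| / seeley_half 1.
Proof.
have S0 := seeley_half1_gt0.
rewrite /seeley_weight normrM [X in _ * X]ger0_norm ?invr_ge0 ?(ltW S0) //.
rewrite ler_wpM2r ?invr_ge0 ?(ltW S0) // normrM ler_piMr // ger0_norm.
  by rewrite invf_le1 ?ler_wpDl ?exp4_ge0 // ltr_wpDl ?exp4_ge0.
by rewrite invr_ge0 addr_ge0 ?exp4_ge0.
Qed.

(** Since [(2 ^ k) ^ (2 j) = (4 ^ j) ^ k], the series is that of [h] at [4 ^ j], divided by
    [h 1]. *)
Lemma seeley_moment j :
  limn (series (fun k => seeley_weight k * (2 ^+ k) ^+ (2 * j))) = (-1) ^+ j.
Proof.
have S0 := seeley_half1_gt0.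
have e0 : 0 < (4 : R) ^+ j by rewrite exprn_gt0.
apply/cvg_lim => //.
have : (fun n => series (fun k => seeley_coef k / (4 ^+ k + 1) * (4 ^+ j) ^+ k) n
    * (seeley_half 1)^-1) @ \oo --> seeley_half (4 ^+ j) * (seeley_half 1)^-1.
  by apply: cvgM; [exact: cvg_seeley_half|exact: cvg_cst].
rewrite seeley_half4 -mulrA mulfV ?gt_eqF // mulr1.
apply: cvg_trans; apply/near_eq_cvg/nearW => n.
rewrite /series /= mulr_suml; apply: eq_bigr => k _.
have -> : (2 ^+ k) ^+ (2 * j) = (4 ^+ j) ^+ k :> R.
  rewrite -!exprM (_ : 4 = 2 ^+ 2 :> R) -?exprM; last by rewrite expr2 -natrM.
  by rewrite mulnCA [(k * j)%N]mulnC.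
by rewrite /seeley_weight mulrAC.
Qed.

End seeley_weights.

(** * Integration over the unit interval *)

Section unit_integral.
Variable R : realType.
Local Notation mu := (@lebesgue_measure R).

Definition unit_integral (phi : R -> R) : R := \int[mu]_(x in `[0, 1]) phi x.

Lemma integrable_unit (phi : R -> R) : continuous phi ->
  mu.-integrable `[0, 1] (EFin \o phi).
Proof.
move=> cphi; apply: continuous_compact_integrable; first exact: segment_compact.
by apply: continuous_subspaceT => x; exact: cphi.
Qed.

Lemma unit_integralD phi psi (c : R) : continuous phi -> continuous psi ->
  unit_integral (fun l => phi l + c * psi l) =
  unit_integral phi + c * unit_integral psi.
Proof.
move=> cphi cpsi; have mI : measurable (`[0, 1]%classic : set R) by [].
rewrite /unit_integral RintegralD ?RintegralZl //; try exact: integrable_unit.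
apply: (@integrable_unit (fun l => c * psi l)) => x.
by apply: cvgM; [exact: cvg_cst|exact: cpsi].
Qed.

Lemma unit_integral_le (phi : R -> R) (M : R) : continuous phi ->
  (forall l, 0 <= l <= 1 -> `|phi l| <= M) -> `|unit_integral phi| <= M.
Proof.
move=> cphi phiM; have mI : measurable (`[0, 1]%classic : set R) by [].
rewrite /unit_integral (le_trans (le_normr_Rintegral _ _)) //.
  exact: integrable_unit.
apply: (@le_trans _ _ (\int[mu]_(x in `[0, 1]) M)).
  apply: le_Rintegral => //.
  - apply: (@integrable_unit (fun l => `|phi l|)) => x.
    by apply: cvg_norm; exact: cphi.
  - by apply: (@integrable_unit (fun=> M)) => x; exact: cvg_cst.
have muI : mu (`[0, 1]%classic : set R) = 1%:E.
  by rewrite lebesgue_measure_itv /= lte_fin ltr01 oppr0 adde0.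
by rewrite Rintegral_cst // [X in fine X]muI mulr1.
Qed.

Lemma unit_integral_derive (F f : R -> R) : continuous f ->
  (forall x : R, is_derive (x : R^o) 1 (F : R^o -> R^o) (f x)) ->
  unit_integral f = F 1 - F 0.
Proof.
move=> cf dF; rewrite /unit_integral /Rintegral.
have cF : continuous F.
  move=> x; apply: differentiable_continuous; apply/derivable1_diffP.
  by have [] := dF x.
rewrite (@continuous_FTC2 R f F 0 1) //=.
- by apply: continuous_subspaceT => x; exact: cf.
- split; first by move=> x _; have [] := dF x.
  + by apply: cvg_at_right_filter; exact: cF.
  + by apply: cvg_at_left_filter; exact: cF.
- by move=> x _; rewrite derive1E; have [] := dF x.
Qed.

Lemma unit_integral_cst (c : R) : unit_integral (fun=> c) = c.
Proof.
have dF (x : R) : is_derive (x : R^o) 1 (fun x : R^o => x * c : R^o) c.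
  by apply: is_derive_eq; rewrite /GRing.scale /= mulr0 add0r mulr1.
by rewrite (unit_integral_derive (@cst_continuous _ _ c) dF) mul1r mul0r subr0.
Qed.

End unit_integral.

(** * The two averages, Hadamard's lemma and parity *)

Section averages.
Variable R : realType.
Local Notation R2 := (R^o * R^o)%type.

Lemma averagingZ (L : (R -> R) -> R) phi c : averaging L -> slowly_growing phi ->
  L (fun l => c * phi l) = c * L phi.
Proof.
move=> aL sphi; have := averagingD aL (c - 1) sphi sphi.
rewrite (_ : (fun l => phi l + (c - 1) * phi l) = (fun l => c * phi l)).
  by move=> ->; ring.
by apply/funext => l; ring.
Qed.

Lemma polybounded_ge0 m (M : R) phi : polybounded m M phi -> 0 <= M.
Proof.
by move=> /(_ 0); rewrite expr0n addr0 expr1n mulr1; apply: le_trans.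
Qed.

Lemma averaging_unit_integral : averaging (@unit_integral R).
Proof.
split=> [phi psi c [cphi _] [cpsi _]|m]; first exact: unit_integralD.
exists (2 ^+ m) => [|phi M cphi phiM]; first by rewrite exprn_ge0.
have M0 := polybounded_ge0 phiM.
apply: unit_integral_le => // l /andP[l0 l1].
rewrite (le_trans (phiM l)) // mulrC ler_wpM2r //.
by rewrite lerXn2r ?nnegrE ?addr_ge0 ?sqr_ge0 //; nra.
Qed.

Definition seeley (phi : R -> R) : R :=
  limn (series (fun k => seeley_weight R k * phi (2 ^+ k))).

(** At [l = 2 ^ k] a growth of order [m] costs [2 ^ m * (4 ^ m) ^ k], which the decay of the weights
    beats for every [m]. *)
Lemma seeley_cvg m : exists2 C : R, 0 <= C & forall phi M, polybounded m M phi ->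
  cvgn (series (fun k => seeley_weight R k * phi (2 ^+ k))) /\
  `|seeley phi| <= C * M.
Proof.
have [C C0 CP] := seeley_coef_decay (exprn_gt0 m (ltr0n R 4)).
have S0 := seeley_half1_gt0 R.
exists (C / seeley_half 1 * 2 ^+ m * 2) => [|phi M phiM].
  by rewrite !mulr_ge0 ?exprn_ge0 // invr_ge0 ltW.
have M0 := polybounded_ge0 phiM.
have q0 : 0 <= (2^-1 : R) by rewrite invr_ge0.
have q1 : (2^-1 : R) < 1 by lra.
suff bk k : `|seeley_weight R k * phi (2 ^+ k)| <=
    (C / seeley_half 1 * 2 ^+ m * M) * 2^-1 ^+ k.
  have [cv le] := series_geometric_le q0 q1 bk.
  split=> //; rewrite /seeley (le_trans le) //.
  have -> : (1 - 2^-1 : R)^-1 = 2 by field.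
  by rewrite mulrAC.
rewrite normrM.
have wk := seeley_weight_le R k.
have phik : `|phi (2 ^+ k)| <= M * (2 ^+ m * (4 ^+ m) ^+ k).
  rewrite (le_trans (phiM _)) // ler_wpM2l //.
  have -> : (4 ^+ m) ^+ k = (4 ^+ k) ^+ m :> R by rewrite -!exprM mulnC.
  rewrite -exprMn lerXn2r ?nnegrE ?addr_ge0 ?sqr_ge0 //.
  have -> : (2 ^+ k) ^+ 2 = 4 ^+ k :> R.
    by rewrite -exprM mulnC exprM; congr (_ ^+ _); rewrite expr2 -natrM.
  have : 1 <= (4 : R) ^+ k by rewrite exprn_ege1 //; lra.
  by move: (4 ^+ k) => u; lra.
apply: (le_trans (ler_pM _ _ wk phik)) => //.
have -> : `|seeley_coef R k| / seeley_half 1 * (M * (2 ^+ m * (4 ^+ m) ^+ k)) =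
    (`|seeley_coef R k| * (4 ^+ m) ^+ k) * ((seeley_half 1)^-1 * 2 ^+ m * M).
  by ring.
rewrite [leRHS](_ : _ = (C * 2^-1 ^+ k) * ((seeley_half 1)^-1 * 2 ^+ m * M)).
  by rewrite ler_wpM2r // !mulr_ge0 ?exprn_ge0 // invr_ge0 ltW.
by ring.
Qed.

Lemma averaging_seeley : averaging seeley.
Proof.
split=> [phi psi c [cphi [m [M phiM]]] [cpsi [m' [M' psiM]]]|m].
  have [C _ /(_ _ _ phiM)[cv1 _]] := seeley_cvg m.
  have [C' _ /(_ _ _ psiM)[cv2 _]] := seeley_cvg m'.
  apply/cvg_lim => //.
  have : (fun n => series (fun k => seeley_weight R k * phi (2 ^+ k)) n +
      c * series (fun k => seeley_weight R k * psi (2 ^+ k)) n) @ \oo -->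
      seeley phi + c * seeley psi.
    by apply: cvgD => //; apply: cvgM => //; exact: cvg_cst.
  apply: cvg_trans; apply/near_eq_cvg/nearW => n.
  rewrite /series /= mulr_sumr -big_split /=; apply: eq_bigr => k _.
  by ring.
have [C C0 CP] := seeley_cvg m; exists C => // phi M _ phiM.
by have [] := CP _ _ phiM.
Qed.

Lemma eq_smear L j (P : R2 -> R^o) (p q : R2) :
  (forall l, P (p.1, l * p.2) = P (q.1, l * q.2)) -> smear L j P p = smear L j P q.
Proof. by move=> Ppq; congr (L _); apply/funext => l; rewrite Ppq. Qed.

Variables a d : R.
Local Notation strip := (@strip R a d).

Definition bsmooth (P : R2 -> R^o) := forall k, Ck true k strip P.

Lemma bsmooth_derive P v : bsmooth P -> bsmooth ('D_v P).
Proof. by move=> CP k; have [_ _] := CP k.+1; exact. Qed.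

Lemma bsmooth_diff P p : bsmooth P -> strip p -> differentiable P p.
Proof. by move=> CP; have [+ _ _] := CP 0; exact. Qed.

Lemma bsmooth_smear L j P : averaging L -> bsmooth P -> bsmooth (smear L j P).
Proof. by move=> aL bP k; exact: smear_Ck. Qed.

Lemma slowly_growing_smear j P p : bsmooth P -> strip p ->
  slowly_growing (fun l => l ^+ j * P (p.1, l * p.2)).
Proof.
move=> bP sp; have [dP /(_ isT)[M PM] _] := bP 0.
have [cP bdP] := slowly_growing_slice j sp dP PM.
by split=> //; exists j, M.
Qed.

Lemma is_derive_fst (P : R2 -> R^o) (p : R2) : differentiable P p ->
  is_derive (p.1 : R^o) 1 (fun s : R^o => P (s, p.2)) ('D_(1, 0) P p).
Proof.
case: p => s t dP /=.
have E (u : R) : (u, t) = u *: ((1, 0) : R2) + (0, t).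
  by congr pair; rewrite /= /GRing.scale /= ?mulr1 ?mulr0 ?addr0 ?add0r.
have -> : (fun s : R^o => P (s, t)) = (fun u : R^o => P (u *: ((1, 0) : R2) + (0, t))).
  by apply/funext => u; rewrite -E.
by rewrite [in 'D_(1, 0) P _]E; apply: is_derive_line; rewrite -E.
Qed.

Lemma is_derive_snd (P : R2 -> R^o) (p : R2) : differentiable P p ->
  is_derive (p.2 : R^o) 1 (fun t : R^o => P (p.1, t)) ('D_(0, 1) P p).
Proof.
case: p => s t dP /=.
have E (u : R) : (s, u) = u *: ((0, 1) : R2) + (s, 0).
  by congr pair; rewrite /= /GRing.scale /= ?mulr1 ?mulr0 ?addr0 ?add0r.
have -> : (fun t : R^o => P (s, t)) = (fun u : R^o => P (u *: ((0, 1) : R2) + (s, 0))).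
  by apply/funext => u; rewrite -E.
by rewrite [in 'D_(0, 1) P _]E; apply: is_derive_line; rewrite -E.
Qed.

(** Integrate [d/dl P (s, l t) = t P_t (s, l t)] over [0 <= l <= 1]. The quotient is a [smear],
    hence has bounded derivatives again. *)
Lemma hadamard P p : bsmooth P -> (forall s, strip (s, 0) -> P (s, 0) = 0) ->
  strip p -> P p = p.2 * smear (@unit_integral R) 0 ('D_(0, 1) P) p.
Proof.
move=> bP P0 sp; pose f l := p.2 * (l ^+ 0 * 'D_(0, 1) P (p.1, l * p.2)).
have sg := slowly_growing_smear 0 (bsmooth_derive (0, 1) bP) sp.
rewrite /smear -averagingZ //; last exact: averaging_unit_integral.
have dF (l : R) : is_derive (l : R^o) 1 (fun l : R^o => P (p.1, l * p.2) : R^o) (f l).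
  rewrite /f expr0 mul1r mulrC; have spl : strip (p.1, l * p.2) by [].
  have := is_derive_snd (bsmooth_diff bP spl) => /= dP.
  apply: (@is_derive1_comp R (fun t => P (p.1, t)) (fun l => l * p.2)) => //.
  by apply: is_derive_eq; rewrite /GRing.scale /= mulr0 add0r mulr1.
rewrite (unit_integral_derive _ dF).
  by rewrite mul1r mul0r P0 ?subr0; case: (p) sp.
move=> l; have [+ _] := sg => /(_ l) cl.
by apply: cvgM => //; exact: cvg_cst.
Qed.

(** The reflection [(s, t) -> (s, - t)] fixes [(1, 0)] and negates [(0, 1)]; thus a derivative in
    [s] keeps the parity and one in [t] reverses it. *)
Lemma derive_parity (f : R2 -> R^o) (e : R) :
  (forall p, strip p -> differentiable f p) ->
  (forall p, strip p -> f (p.1, - p.2) = e * f p) ->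
  forall p, strip p ->
    'D_(1, 0) f (p.1, - p.2) = e * 'D_(1, 0) f p /\
    'D_(0, 1) f (p.1, - p.2) = - e * 'D_(0, 1) f p.
Proof.
move=> df fe p sp; pose h (q : R2) : R2 := (q.1, - q.2).
have hp : strip (h p) by [].
have E v : 'D_(h v) f (h p) = e * 'D_v f p.
  rewrite -(@derive_affine R R2 R2 R^o f h h).
    have -> : e * 'D_v f p = 'D_v (fun q => e * f q) p.
      by apply/esym/deriveZ; apply/diff_derivable/df.
    apply: near_eq_derive; near=> q; apply: fe; near: q.
    exact: open_nbhs_nbhs (conj (@open_strip R a d) sp).
  move=> u; apply: injective_projections => //=.
  by rewrite /GRing.scale /= opprD mulrN.
split; first by rewrite -E; congr ('D__ f _); congr pair; rewrite /= oppr0.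
have := E (0, 1); rewrite derive_pairE /=; last exact: df.
by rewrite mul0r add0r mulN1r mulNr => <-; rewrite opprK.
Unshelve. all: by end_near. Qed.

Definition even_bsmooth (K : R2 -> R^o) :=
  bsmooth K /\ forall p, strip p -> K (p.1, - p.2) = K p.

(* For [K] even, [even_div K (s, t)] is [dK/dt (s, t) / (2 t)]: it is the
   derivative of [K (s, sqrt v)] with respect to [v] at [v = t ^+ 2]. *)
Definition even_div (K : R2 -> R^o) : R2 -> R^o :=
  fun p => 2^-1 * smear (@unit_integral R) 0 ('D_(0, 1) ('D_(0, 1) K)) p.

(** [K_t] is odd, so it vanishes at [t = 0] and Hadamard's lemma divides it by [t]. *)
Lemma even_div_derive K p : even_bsmooth K -> strip p ->
  'D_(0, 1) K p = 2 * p.2 * even_div K p.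
Proof.
move=> [bK eK] sp; rewrite {1}(hadamard (bsmooth_derive (0, 1) bK) _ sp).
  by rewrite /even_div; field.
move=> s ss; have [||_] := @derive_parity K 1 _ _ (s, 0) ss.
- by move=> q sq; exact: bsmooth_diff.
- by move=> q sq; rewrite eK // mul1r.
by rewrite /= oppr0 mulN1r => /eqP; rewrite -addr_eq0 -mulr2n mulrn_eq0 => /eqP.
Qed.

(** Two derivatives in [t] restore evenness, which dilations preserve; hence [even_div] can be
    iterated. *)
Lemma even_bsmooth_div K : even_bsmooth K -> even_bsmooth (even_div K).
Proof.
move=> [bK eK]; split.
  move=> k; apply: CkZ; first exact: open_strip.
  by apply: bsmooth_smear; [exact: averaging_unit_integral|do 2 apply: bsmooth_derive].
move=> p sp; rewrite /even_div.
apply: (congr1 (fun u => 2^-1 * u)).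
apply: eq_smear => l.
rewrite -[LHS]/('D_(0, 1) ('D_(0, 1) K) (p.1, l * - p.2)).
rewrite mulrN.
have spl : strip (p.1, l * p.2) by [].
have par1 q : strip q -> 'D_(0, 1) K (q.1, - q.2) = -1 * 'D_(0, 1) K q.
  move=> sq; have [||_ ->//] := @derive_parity K 1 _ _ _ sq.
    by move=> p' sp'; exact: bsmooth_diff.
  by move=> p' sp'; rewrite eK // mul1r.
have [|_] := @derive_parity ('D_(0, 1) K) (-1) _ par1 _ spl.
  by move=> q sq; apply: bsmooth_diff => //; exact: bsmooth_derive.
by rewrite opprK mul1r.
Qed.

Lemma even_bsmooth_derive1 K : even_bsmooth K -> even_bsmooth ('D_(1, 0) K).
Proof.
move=> [bK eK]; split; first exact: bsmooth_derive.
move=> p sp; have [||-> _] := @derive_parity K 1 _ _ _ sp.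
- by move=> p' sp'; exact: bsmooth_diff.
- by move=> p' sp'; rewrite eK // mul1r.
by rewrite mul1r.
Qed.

End averages.

(** * Extension of an even function of sqrt v to v < 0 *)

Section gluing.
Variable R : realType.
Local Notation R2 := (R^o * R^o)%type.

(** The condition [0 < (x - t) / h < 1] places [x] strictly between [t] and [t + h] for either sign
    of [h]. The endpoints are left out because [t] may lie on the line of gluing. *)
Lemma MVT_between (g g' : R -> R) (t h : R) :
  (forall x, 0 < (x - t) / h < 1 -> is_derive (x : R^o) 1 (g : R^o -> R^o) (g' x)) ->
  continuous g -> exists2 x, `|x - t| <= `|h| & g (t + h) - g t = g' x * h.
Proof.
move=> dg cg; case: (ltrgtP h 0) => h0; last first.
- by exists t; rewrite ?subrr ?normr0 // h0 addr0 subrr mulr0.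
- have tth : t < t + h by rewrite ltrDl.
  have D (x : R) : x \in `]t, (t + h)[ -> is_derive (x : R^o) 1 (g : R^o -> R^o) (g' x).
    rewrite in_itv /= => /andP[tx xth]; apply: dg.
    by rewrite divr_gt0 ?subr_gt0 //= ltr_pdivrMr // mul1r ltrBlDl.
  have C : {within `[t, (t + h)], continuous g}.
    by apply: continuous_subspaceT => x; exact: cg.
  have [x + ->] := MVT tth D C; rewrite in_itv /= => /andP[tx xth].
  exists x; last by rewrite addrC addKr.
  by rewrite !gtr0_norm ?subr_gt0 // lerBlDl ltW.
have tth : t + h < t by rewrite gtrDl.
have D (x : R) : x \in `](t + h), t[ -> is_derive (x : R^o) 1 (g : R^o -> R^o) (g' x).
  rewrite in_itv /= => /andP[tx xth]; apply: dg.
  by rewrite nmulr_lgt0 ?invr_lt0 // subr_lt0 xth /= ltr_ndivrMr // mul1r ltrBrDl.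
have C : {within `[(t + h), t], continuous g}.
  by apply: continuous_subspaceT => x; exact: cg.
have [x + gE] := MVT tth D C; rewrite in_itv /= => /andP[tx xth].
exists x; first by rewrite !ltr0_norm ?subr_lt0 // opprB; lra.
by rewrite -opprB gE opprD addrA subrr sub0r mulrN opprK.
Qed.

(** The increment is split into a horizontal step, controlled by [f1] at [p], and a vertical one,
    controlled by the mean value theorem. The latter needs [f2] to be the derivative only off the
    line [t = 0]; continuity of [f2] at [p] does the rest. *)
Lemma C1_strip (f f1 f2 : R2 -> R^o) (a d : R) (p : R2) :
  (forall p, strip a d p ->
    is_derive (p.1 : R^o) 1 (fun s : R^o => f (s, p.2)) (f1 p)) ->
  (forall p, strip a d p -> p.2 != 0 ->
    is_derive (p.2 : R^o) 1 (fun t : R^o => f (p.1, t)) (f2 p)) ->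
  (forall s : R, `|s - a| < d -> continuous (fun t : R => f (s, t) : R)) ->
  {for p, continuous f2} -> strip a d p ->
  differentiable f p /\ forall v, 'D_v f p = v.1 * f1 p + v.2 * f2 p.
Proof.
case: p => s t df1 df2 cf cf2 sp; apply: is_diff_pair_eps => e e0.
have [d1 d10 P1] : exists2 d1 : R, 0 < d1 & forall h : R, `|h| < d1 ->
    `|f (h + s, t) - f (s, t) - h * f1 (s, t)| <= e * `|h|.
  have df1s := df1 _ sp; have [/derivable1_diffP dfs dfE] := df1s.
  have := diff_eps dfs e0 => /nbhs_norm0P[d1 d10 P1]; exists d1 => // h hd.
  have := P1 h hd; rewrite /= -[X in 'd _ _ X]mulr1 -[h * 1]/(h *: (1 : R^o)).
  by rewrite linearZ /= -deriveE // dfE.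
have [d2 d20 P2] : exists2 d2 : R, 0 < d2 & forall h1 h2 : R, `|h1| < d2 -> `|h2| < d2 ->
    `|f2 (h1 + s, h2 + t) - f2 (s, t)| <= e.
  have : \forall q \near (s, t), `|f2 (s, t) - f2 q| < e.
    by move/cvgr_dist_lt: cf2; exact.
  move=> [[A B] /= [/nbhs_ballP[u /= u0 uA] /nbhs_ballP[w /= w0 wB]] AB].
  exists (Num.min u w); first by rewrite lt_min u0.
  move=> h1 h2; rewrite !lt_min => /andP[h1u _] /andP[_ h2w].
  rewrite distrC ltW //; apply: (AB (h1 + s, h2 + t)); split.
    by apply: uA; rewrite /ball /= opprD addrCA subrr addr0 normrN.
  by apply: wB; rewrite /ball /= opprD addrCA subrr addr0 normrN.
have sd : 0 < d - `|s - a| by rewrite subr_gt0.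
(* If [t != 0], the bound [|h2| < |t|] keeps the vertical segment off the line; if [t = 0], only its
   endpoint lies there and any positive bound works. *)
pose t0 := if t == 0 then 1 else `|t|.
have t00 : 0 < t0 by rewrite /t0; case: eqVneq => // ?; rewrite normr_gt0.
exists (Num.min (Num.min d1 d2) (Num.min (d - `|s - a|) t0)).
  by rewrite !lt_min d10 d20 sd.
move=> [h1 h2] /=; rewrite !lt_min -!andbA => /and4P[h11 h12 h1s _] /and4P[_ h22 _ h2t].
have sh : `|h1 + s - a| < d.
  by rewrite -addrA (le_lt_trans (ler_normD _ _)) // -ltrBrDr.
have [|x xt fE] := @MVT_between (fun u => f (h1 + s, u)) (fun u => f2 (h1 + s, u)) t h2
  _ (cf _ sh).
  move=> x /andP[x0 x1]; apply: (df2 (h1 + s, x)) => //=.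
  apply/eqP => xE; move: x0 x1; rewrite xE sub0r; move: h2t; rewrite /t0.
  have [->|tn0] := eqVneq t 0; first by rewrite oppr0 mul0r ltxx.
  move=> h2t x0 x1; have h20 : 0 < `|h2|.
    by rewrite normr_gt0; apply: contraTneq x0 => ->; rewrite invr0 mulr0 ltxx.
  have : `|- t / h2| < 1 by rewrite gtr0_norm.
  by rewrite normrM normrN normfV ltr_pdivrMr // mul1r ltNge (ltW h2t).
have -> : f (h1 + s, h2 + t) - f (s, t) - (h1 * f1 (s, t) + h2 * f2 (s, t)) =
   (f (h1 + s, t) - f (s, t) - h1 * f1 (s, t)) +
   (f2 (h1 + s, (x - t) + t) - f2 (s, t)) * h2.
  by rewrite subrK mulrBl -fE [h2 + t]addrC; ring.
rewrite (le_trans (ler_normD _ _)) // mulrDr lerD ?P1 // normrM ler_wpM2r //.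
by apply: P2 => //; exact: le_lt_trans h22.
Qed.

End gluing.

(** * The glued function and its derivatives *)

Section sqrt_extension.
Variables (R : realType) (a d : R).
Local Notation R2 := (R^o * R^o)%type.
Local Notation strip := (@strip R a d).

(* Extends [K (s, sqrt v)], [K] even, to [v < 0]: for [j = 0] the right-hand
   side is a smooth substitute for "[K (s, i sqrt (- v))]" with the same Taylor
   expansion at [v = 0].  Since [sqrt] vanishes on negative numbers, each of the
   first two terms is constant on the half-plane where it is not meant to act. *)
Definition sqrt_ext (j : nat) (K : R2 -> R^o) : R2 -> R^o := fun p =>
  K (p.1, Num.sqrt p.2)
  + (-1) ^+ j * smear (@seeley R) (2 * j) K (p.1, Num.sqrt (- p.2))
  - K (p.1, 0).

(** The integrand is [K (s, 0) * l ^+ (2 * j)], so this is the moment condition; it makes the two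
    halves of [sqrt_ext] meet at [v = 0]. *)
Lemma smear_seeley0 j (K : R2 -> R^o) (s : R) :
  (-1) ^+ j * smear (@seeley R) (2 * j) K (s, 0) = K (s, 0).
Proof.
have sg : slowly_growing (fun l : R => l ^+ (2 * j)).
  split; first exact: exprn_continuous.
  exists (2 * j)%N, 1 => l; rewrite mul1r normrX lerXn2r ?nnegrE ?addr_ge0 ?sqr_ge0 //.
  rewrite -[X in _ + X]real_normK ?num_real //.
  by have := normr_ge0 l; move: `|l| => u u0; nra.
have -> : smear (@seeley R) (2 * j) K (s, 0) =
    seeley (fun l => K (s, 0) * l ^+ (2 * j)).
  by congr seeley; apply/funext => l; rewrite /= mulr0 mulrC.
rewrite (averagingZ _ (averaging_seeley R) sg) /seeley seeley_moment.
by rewrite mulrCA -expr2 sqrr_sign mulr1.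
Qed.

Lemma sqrt_ext_ge0 j K p : 0 <= p.2 -> sqrt_ext j K p = K (p.1, Num.sqrt p.2).
Proof.
move=> p0; rewrite /sqrt_ext (@ler0_sqrtr _ (- p.2)) ?oppr_le0 //.
by rewrite smear_seeley0 addrK.
Qed.

Lemma sqrt_ext_le0 j K p : p.2 <= 0 -> sqrt_ext j K p =
  (-1) ^+ j * smear (@seeley R) (2 * j) K (p.1, Num.sqrt (- p.2)).
Proof. by move=> p0; rewrite /sqrt_ext (ler0_sqrtr p0) addrAC subrr add0r. Qed.

Lemma continuous_comp_snd (P : R2 -> R^o) (u : R -> R) (p : R2) :
  {for (p.1, u p.2), continuous P} -> continuous u ->
  {for p, continuous (fun p : R2 => P (p.1, u p.2) : R^o)}.
Proof.
move=> cP cu.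
have c1 : (fst : R2 -> R^o) @ p --> p.1 by exact: cvg_fst.
have c2 : (fun q : R2 => u q.2 : R^o) @ p --> (u p.2 : R^o).
  by apply: (@continuous_comp R2 R R snd u); [exact: cvg_snd|exact: cu].
exact: (cvg_comp _ P (cvg_pair c1 c2) cP).
Qed.

(** Each of the three terms of [sqrt_ext] is continuous on both sides of [v = 0], so no case
    distinction arises. *)
Lemma continuous_sqrt_ext j K p : bsmooth a d K -> strip p ->
  {for p, continuous (sqrt_ext j K)}.
Proof.
move=> bK sp; have cK (P : R2 -> R^o) t : bsmooth a d P -> {for (p.1, t), continuous P}.
  by move=> bP; apply: differentiable_continuous; exact: (bsmooth_diff bP).
have bS := bsmooth_smear (2 * j) (averaging_seeley R) bK.
rewrite /sqrt_ext; apply: (@cvgB _ R^o); last first.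
  by apply: (@continuous_comp_snd K (fun=> 0)); [exact: cK|move=> x; exact: cvg_cst].
apply: (@cvgD _ R^o).
  by apply: continuous_comp_snd; [exact: cK|exact: sqrt_continuous].
apply: cvgM; first exact: cvg_cst.
apply: (@continuous_comp_snd _ (fun t => Num.sqrt (- t))); first exact: cK.
move=> x; apply: (@continuous_comp R R R -%R Num.sqrt); first exact: oppr_continuous.
exact: sqrt_continuous.
Qed.

Lemma is_derive_sqrt_ext_fst j K p : bsmooth a d K -> strip p ->
  is_derive (p.1 : R^o) 1 (fun s : R^o => sqrt_ext j K (s, p.2))
    (sqrt_ext j ('D_(1, 0) K) p).
Proof.
move=> bK sp.
have dK t : is_derive (p.1 : R^o) 1 (fun s : R^o => K (s, t)) ('D_(1, 0) K (p.1, t)).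
  exact: (is_derive_fst (bsmooth_diff bK (sp : strip (p.1, t)))).
have dS t : is_derive (p.1 : R^o) 1 (fun s : R^o => smear (@seeley R) (2 * j) K (s, t))
    (smear (@seeley R) (2 * j) ('D_(1, 0) K) (p.1, t)).
  have [dSt SE] := smear_diff (averaging_seeley R) (2 * j) (bK 2) (sp : strip (p.1, t)).
  have := is_derive_fst dSt; rewrite SE /=.
  by rewrite mul1r mul0r addr0.
exact: (is_deriveB (is_deriveD (dK (Num.sqrt p.2))
  (is_deriveZ ((-1) ^+ j) (dS (Num.sqrt (- p.2))))) (dK 0)).
Qed.

(** For [v > 0], [K_t / (2 sqrt v)] is [even_div K] at [sqrt v]. For [v < 0], the derivative of
    [sqrt (- v)] is [- 1 / (2 sqrt (- v))]; its sign and the two extra factors [l] under the sum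
    change [j] into [j.+1]. *)
Lemma is_derive_sqrt_ext_snd j K p : even_bsmooth a d K -> strip p -> p.2 != 0 ->
  is_derive (p.2 : R^o) 1 (fun t : R^o => sqrt_ext j K (p.1, t))
    (sqrt_ext j.+1 (even_div K) p).
Proof.
case: p => s t [bK eK] /= sp t0.
have eKK : even_bsmooth a d K by [].
case: (ltrgtP t 0) t0 => // t0 _; last first.
  rewrite sqrt_ext_ge0 ?ltW //=; pose f (u : R) := K (s, Num.sqrt u).
  apply: (@near_eq_is_derive _ _ _ f).
    near=> u; rewrite sqrt_ext_ge0 //= ltW //.
    by near: u; exact: lt_nbhsr.
  have st0 : 0 < Num.sqrt t by rewrite sqrtr_gt0.
  have ds := is_derive1_sqrt t0.
  have dK := is_derive_snd (bsmooth_diff bK (sp : strip (s, Num.sqrt t))).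
  apply: is_derive_eq (is_derive1_comp dK ds) _.
  rewrite (even_div_derive eKK (sp : strip (s, Num.sqrt t))) /=.
  by rewrite mulrAC divff ?mul1r // mulf_neq0 // gt_eqF.
rewrite sqrt_ext_le0 ?ltW //=.
pose f (u : R) := (-1) ^+ j * smear (@seeley R) (2 * j) K (s, Num.sqrt (- u)).
apply: (@near_eq_is_derive _ _ _ f).
  near=> u; rewrite sqrt_ext_le0 //= ltW //.
  by near: u; exact: lt_nbhsl.
have nt0 : 0 < - t by rewrite oppr_gt0.
have st0 : 0 < Num.sqrt (- t) by rewrite sqrtr_gt0.
have sq : strip (s, Num.sqrt (- t)) by [].
have ds : is_derive (t : R^o) 1 (fun u : R^o => Num.sqrt (- u) : R^o)
    ((2 * Num.sqrt (- t))^-1 * -1).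
  have dN : is_derive (t : R^o) 1 (-%R : R^o -> R^o) (-1) := is_deriveNid _ _.
  exact: (is_derive1_comp (is_derive1_sqrt nt0) dN).
have [dS SE] := smear_diff (averaging_seeley R) (2 * j) (bK 2) sq.
have dSs := is_derive_snd dS.
have := is_deriveZ ((-1) ^+ j) (@is_derive1_comp R
  (fun u => smear (@seeley R) (2 * j) K (s, u)) (fun u => Num.sqrt (- u)) t _ _ dSs ds).
rewrite SE /= mul0r add0r mul1r.
(* One factor [l] comes from the chain rule, the other from [K_t = 2 t even_div K] taken at the
   dilated point. *)
have -> : smear (@seeley R) (2 * j).+1 ('D_(0, 1) K) (s, Num.sqrt (- t)) =
    2 * Num.sqrt (- t) * smear (@seeley R) (2 * j.+1) (even_div K) (s, Num.sqrt (- t)).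
  rewrite /smear -averagingZ; first last.
  - by apply: (slowly_growing_smear _ _ sq); have [] := even_bsmooth_div eKK.
  - exact: averaging_seeley.
  congr seeley; apply/funext => l.
  rewrite (even_div_derive eKK (sp : strip (s, l * Num.sqrt (- t)))) /=.
  have -> : (2 * j.+1 = (2 * j).+2)%N by rewrite mulnS.
  rewrite [l ^+ (2 * j).+2]exprS.
  by move: (l ^+ (2 * j).+1) (even_div K _) => u v; ring.
move=> dd; apply: (is_derive_eq dd); rewrite /GRing.scale /= exprS.
move: (smear _ _ _ _) => u; field.
by rewrite gt_eqF.
Unshelve. all: by end_near. Qed.

Lemma sqrt_ext_derive j K p : even_bsmooth a d K -> strip p ->
  differentiable (sqrt_ext j K) p /\ forall v, 'D_v (sqrt_ext j K) p =
    v.1 * sqrt_ext j ('D_(1, 0) K) p + v.2 * sqrt_ext j.+1 (even_div K) p.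
Proof.
move=> eK sp; have [bK _] := eK; have [bK' _] := even_bsmooth_div eK.
apply: (@C1_strip R (sqrt_ext j K) _ _ a d) => //.
- by move=> q sq; exact: is_derive_sqrt_ext_fst.
- by move=> q sq q0; exact: is_derive_sqrt_ext_snd.
- move=> s ss t.
  have c1 : (fun=> s : R^o) @ (t : R^o) --> (s : R^o) by exact: cvg_cst.
  have c2 : (id : R^o -> R^o) @ t --> (t : R^o) by exact: cvg_id.
  have cS := @continuous_sqrt_ext j K (s, t) bK ss.
  exact: (cvg_comp _ (sqrt_ext j K) (cvg_pair c1 c2) cS).
- exact: continuous_sqrt_ext.
Qed.

Lemma sqrt_ext_Ck k j K : even_bsmooth a d K -> Ck false k strip (sqrt_ext j K).
Proof.
elim: k j K => [|k IH] j K eK.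
  by split=> // x sx; have [] := sqrt_ext_derive j eK sx.
split=> // [x sx|v]; first by have [] := sqrt_ext_derive j eK sx.
have os := @open_strip R a d.
apply: (eq_Ck os) (CkD os (CkZ v.1 os (IH j _ (even_bsmooth_derive1 eK)))
  (CkZ v.2 os (IH j.+1 _ (even_bsmooth_div eK)))) => p sp.
by have [_ ->] := sqrt_ext_derive j eK sp.
Qed.

End sqrt_extension.

(** * The inverse square root and the substitution by sin o arctan *)

Section reciprocal_sqrt.
Variable R : realType.
Local Notation R2 := (R^o * R^o)%type.

(** Preferred to the square root as a building block: its derivative [- rsqrt ^ 3 / 2] is a
    polynomial in itself, so that smoothness is a direct induction. *)
Definition rsqrt (x : R) : R := (Num.sqrt x)^-1.

Lemma rsqrt_gt0 x : 0 < x -> 0 < rsqrt x.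
Proof. by move=> x0; rewrite invr_gt0 sqrtr_gt0. Qed.

Lemma rsqrt_sqr x : 0 < x -> rsqrt x ^+ 2 = x^-1.
Proof. by move=> x0; rewrite exprVn sqr_sqrtr // ltW. Qed.

Lemma is_derive_rsqrt (x : R) : 0 < x ->
  is_derive (x : R^o) 1 (rsqrt : R^o -> R^o) (- 2^-1 * rsqrt x ^+ 3).
Proof.
move=> x0; have s0 : Num.sqrt x != 0 by rewrite gt_eqF // sqrtr_gt0.
apply: (is_derive_eq (is_deriveV s0 (is_derive1_sqrt x0))); rewrite /rsqrt /GRing.scale /=.
by field.
Qed.

Lemma derive_comp_snd (g : R^o -> R^o) (g' : R) (p : R2) : is_derive p.2 1 g g' ->
  differentiable (fun q : R2 => g q.2 : R^o) p /\
  forall v, 'D_v (fun q : R2 => g q.2 : R^o) p = v.2 * g'.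
Proof.
move=> [/derivable1_diffP dg gE]; split.
  apply: (@differentiable_comp _ R2 R^o R^o snd g) => //.
  by apply: linear_differentiable => x; exact: cvg_snd.
move=> v; rewrite -[LHS]/('D_v (g \o (snd : R2 -> R^o)) p).
rewrite (@derive_affine _ R^o R2 R^o g snd snd) // deriveE //.
by rewrite -{1}[v.2]mulr1 -[v.2 * 1]/(v.2 *: (1 : R^o)) linearZ /= -deriveE // gE.
Qed.

Lemma open_snd_gt0 : open [set q : R2 | 0 < q.2].
Proof.
rewrite -[X in open X]/((snd : R2 -> R) @^-1` [set x : R | 0 < x]).
by apply: open_comp; [move=> p _; exact: cvg_snd|exact: open_gt].
Qed.

(** Stated on [R2] through the second coordinate, the form of outer function that [Ck_comp]
    accepts. *)
Lemma rsqrt_Ck k : Ck false k [set q : R2 | 0 < q.2] (fun q => rsqrt q.2 : R^o).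
Proof.
elim: k => [|k IH].
  by split=> // q /= q0; have [] := derive_comp_snd (is_derive_rsqrt q0).
split=> // [q /= q0|v]; first by have [] := derive_comp_snd (is_derive_rsqrt q0).
have oS := open_snd_gt0.
apply: (eq_Ck oS) (CkZ (v.2 * - 2^-1) oS (CkM oS IH (CkM oS IH IH))) => q /= q0.
have [_ ->] := derive_comp_snd (is_derive_rsqrt q0).
by rewrite !exprS expr0 mulr1 -mulrA.
Qed.

Lemma Ck_rsqrt (V : normedModType R) k (A : set V) (f : V -> R^o) : open A ->
  (forall x, A x -> 0 < f x) -> Ck false k A f ->
  Ck false k A (fun x => rsqrt (f x) : R^o).
Proof.
move=> oA f0 Cf.
exact: (Ck_comp (f := fun q : R2 => rsqrt q.2 : R^o) (g1 := fun=> 0) oA f0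
  (rsqrt_Ck k) (Ck_cst _ _ _ 0) Cf).
Qed.

Definition cosarctan (t : R) : R := rsqrt (1 + t ^+ 2).
Definition sinarctan (t : R) : R := t * cosarctan t.

Lemma onesqr_gt0 (t : R) : 0 < 1 + t ^+ 2.
Proof. by rewrite ltr_wpDr // sqr_ge0. Qed.

Lemma cosarctan_sqr t : cosarctan t ^+ 2 = (1 + t ^+ 2)^-1.
Proof. by rewrite rsqrt_sqr // onesqr_gt0. Qed.

Lemma cosarctan_gt0 t : 0 < cosarctan t.
Proof. by rewrite rsqrt_gt0 // onesqr_gt0. Qed.

Lemma is_derive_cosarctan (t : R) :
  is_derive (t : R^o) 1 (cosarctan : R^o -> R^o) (- sinarctan t * cosarctan t ^+ 2).
Proof.
have d1 : is_derive (t : R^o) 1 (fun t : R^o => 1 + t ^+ 2 : R^o) (2 * t).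
  apply: is_derive_eq.
  by rewrite /GRing.scale /= add0r; ring.
have dd := @is_derive1_comp R rsqrt (fun t => 1 + t ^+ 2) t _ _
  (is_derive_rsqrt (onesqr_gt0 t)) d1.
rewrite (_ : cosarctan = rsqrt \o (fun t => 1 + t ^+ 2)) //.
apply: (is_derive_eq dd).
rewrite /sinarctan /cosarctan /=; move: (rsqrt _) => r.
have h : 2^-1 * 2 = 1 :> R by rewrite mulVf.
by transitivity (- (2^-1 * 2) * r ^+ 3 * t); [|rewrite h]; ring.
Qed.

Lemma is_derive_sinarctan (t : R) :
  is_derive (t : R^o) 1 (sinarctan : R^o -> R^o) (cosarctan t ^+ 3).
Proof.
have dc := is_derive_cosarctan t.
apply: (is_derive_eq (is_deriveM (is_derive_id (t : R^o) 1) dc)).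
rewrite /GRing.scale /= mulr1 /sinarctan.
have e : cosarctan t ^+ 2 * (1 + t ^+ 2) = 1.
  by rewrite cosarctan_sqr mulVf // gt_eqF // onesqr_gt0.
set c := cosarctan t in e *.
have -> : c ^+ 3 = c * c ^+ 2 by rewrite exprS.
rewrite -[in RHS](addrK (c * c ^+ 2 * t ^+ 2) (c * c ^+ 2)).
have -> : c * c ^+ 2 + c * c ^+ 2 * t ^+ 2 = c * (c ^+ 2 * (1 + t ^+ 2)) by ring.
by rewrite e; ring.
Qed.

Lemma cosarctan_le1 t : `|cosarctan t| <= 1.
Proof.
rewrite gtr0_norm ?cosarctan_gt0 // -(@ler_pXn2r _ 2) ?nnegrE ?(ltW (cosarctan_gt0 t)) //.
by rewrite cosarctan_sqr expr1n invf_le1 ?onesqr_gt0 // lerDl sqr_ge0.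
Qed.

Lemma sinarctan_le1 t : `|sinarctan t| < 1.
Proof.
rewrite -(@ltr_pXn2r _ 2) ?nnegrE // expr1n real_normK ?num_real //.
by rewrite exprMn cosarctan_sqr ltr_pdivrMr ?onesqr_gt0 // mul1r ltrDr.
Qed.

(** The derivatives [- s c ^ 2] of [c] and [c ^ 3] of [s] are polynomials in these two functions
    bounded by 1; hence the joint induction. *)
Lemma Ck_arctan k (A : set R2) : open A ->
  Ck true k A (fun q => cosarctan q.2 : R^o) /\
  Ck true k A (fun q => sinarctan q.2 : R^o).
Proof.
move=> oA.
have dc (q : R2) := derive_comp_snd (is_derive_cosarctan q.2).
have ds (q : R2) := derive_comp_snd (is_derive_sinarctan q.2).
elim: k => [|k [IHc IHs]]; split.
- split=> // [q _|_]; first by have [] := dc q.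
  by exists 1 => q _; exact: cosarctan_le1.
- split=> // [q _|_]; first by have [] := ds q.
  by exists 1 => q _; exact/ltW/sinarctan_le1.
- split=> // [q _|_|v]; first by have [] := dc q.
    by exists 1 => q _; exact: cosarctan_le1.
  apply: (eq_Ck oA) (CkZ (- v.2) oA (CkM oA IHs (CkM oA IHc IHc))) => q _.
  by have [_ ->] := dc q; rewrite expr2; ring.
- split=> // [q _|_|v]; first by have [] := ds q.
    by exists 1 => q _; exact/ltW/sinarctan_le1.
  apply: (eq_Ck oA) (CkZ v.2 oA (CkM oA IHc (CkM oA IHc IHc))) => q _.
  by have [_ ->] := ds q; rewrite !exprS expr0 mulr1.
Qed.

End reciprocal_sqrt.

(** * Orthogonal transformations *)

Section householder.
Variables (R : realType) (n : nat).
Local Notation E := 'cV[R]_n.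
Implicit Types x y z a b : E.

Lemma edotE x y : edot x y = (x^T *m y) ord0 ord0.
Proof. by rewrite mxE; apply: eq_bigr => i _; rewrite mxE. Qed.

Lemma edotC x y : edot x y = edot y x.
Proof. by apply: eq_bigr => i _; rewrite mulrC. Qed.

Lemma edotDl x y z : edot (x + y) z = edot x z + edot y z.
Proof. by rewrite /edot -big_split; apply: eq_bigr => i _; rewrite mxE mulrDl. Qed.

Lemma edotZl c x y : edot (c *: x) y = c * edot x y.
Proof. by rewrite /edot mulr_sumr; apply: eq_bigr => i _; rewrite mxE mulrA. Qed.

Lemma edotDr x y z : edot x (y + z) = edot x y + edot x z.
Proof. by rewrite edotC edotDl !(edotC x). Qed.

Lemma edotZr c x y : edot x (c *: y) = c * edot x y.
Proof. by rewrite edotC edotZl edotC. Qed.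

Lemma edotNl x y : edot (- x) y = - edot x y.
Proof. by rewrite -scaleN1r edotZl mulN1r. Qed.

Lemma edotNr x y : edot x (- y) = - edot x y.
Proof. by rewrite edotC edotNl edotC. Qed.

Lemma edot0l x : edot 0 x = 0.
Proof. by rewrite -(scale0r (0 : E)) edotZl mul0r. Qed.

Lemma edot_ge0 x : 0 <= edot x x.
Proof. by apply: sumr_ge0 => i _; rewrite -expr2 sqr_ge0. Qed.

Lemma edot_eq0 x : (edot x x == 0) = (x == 0).
Proof.
apply/eqP/eqP => [x0|->]; last exact: edot0l.
apply/colP => i; rewrite mxE; move/eqP: x0.
rewrite psumr_eq0 => [/allP/(_ i)|j _]; last by rewrite -expr2 sqr_ge0.
by rewrite mem_index_enum => /(_ isT); rewrite mulf_eq0 orbb => /eqP.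
Qed.

Lemma edot_gt0 x : x != 0 -> 0 < edot x x.
Proof. by move=> x0; rewrite lt_def edot_eq0 x0 edot_ge0. Qed.

Lemma enorm_sqr x : enorm x ^+ 2 = edot x x.
Proof. by rewrite /enorm sqr_sqrtr // edot_ge0. Qed.

Lemma enorm_ge0 x : 0 <= enorm x.
Proof. exact: sqrtr_ge0. Qed.

Lemma enorm_gt0 x : x != 0 -> 0 < enorm x.
Proof. by move=> x0; rewrite /enorm sqrtr_gt0 edot_gt0. Qed.

Lemma edot_orthogonal (U : 'M[R]_n) x y : orthogonal_mx U ->
  edot (U *m x) (U *m y) = edot x y.
Proof.
by move=> UU; rewrite !edotE trmx_mul -mulmxA (mulmxA U^T) UU mul1mx.
Qed.

Lemma orthogonal1 : orthogonal_mx (1%:M : 'M[R]_n).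
Proof. by rewrite /orthogonal_mx trmx1 mulmx1. Qed.

Lemma orthogonalM (U V : 'M[R]_n) : orthogonal_mx U -> orthogonal_mx V ->
  orthogonal_mx (U *m V).
Proof.
by move=> UU VV; rewrite /orthogonal_mx trmx_mul -mulmxA (mulmxA U^T) UU mul1mx.
Qed.

Lemma orthogonal_unit (U : 'M[R]_n) : orthogonal_mx U -> U \in unitmx.
Proof. by move=> UU; have [] := mulmx1_unit UU. Qed.

Lemma orthogonal_inv (U : 'M[R]_n) : orthogonal_mx U -> invmx U = U^T.
Proof.
move=> UU; have uU := orthogonal_unit UU.
by rewrite -[LHS]mul1mx -UU -mulmxA mulmxV // mulmx1.
Qed.

Lemma orthogonalV (U : 'M[R]_n) : orthogonal_mx U -> orthogonal_mx (invmx U).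
Proof.
move=> UU; have uU := orthogonal_unit UU.
by rewrite /orthogonal_mx orthogonal_inv // trmxK -orthogonal_inv // mulmxV.
Qed.

(* The reflection in the hyperplane orthogonal to [a - b]. *)
Lemma householder a b : edot a a = edot b b ->
  exists U : 'M[R]_n, [/\ orthogonal_mx U, U *m a = b &
    forall z, edot z a = edot z b -> U *m z = z].
Proof.
move=> ab; have [->|ab0] := eqVneq a b.
  by exists 1%:M; split=> [||z _]; rewrite ?mul1mx //; exact: orthogonal1.
pose w := a - b; have w0 : 0 < edot w w by rewrite edot_gt0 // subr_eq0.
pose c := 2 / edot w w.
pose H : 'M[R]_n := 1%:M - c *: (w *m w^T).
have HE z : H *m z = z - (c * edot w z) *: w.
  rewrite mulmxBl mul1mx -scalemxAl -mulmxA [w^T *m z]mx11_scalar -edotE.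
  by rewrite mul_mx_scalar scalerA.
have HT : H^T = H.
  by rewrite linearB /= trmx1 linearZ /= trmx_mul trmxK.
exists H; split.
(* As [H] is symmetric, orthogonality is [H *m H = 1], checked on the basis vectors with [HE]. *)
- rewrite /orthogonal_mx HT; apply/matrixP => i j.
  have -> : (H *m H) i j = (H *m (H *m delta_mx j (0 : 'I_1))) i ord0.
    by rewrite mulmxA -colE [RHS]mxE.
  rewrite !HE edotDr edotNr edotZr.
  have -> : (c * (edot w (delta_mx j 0) - c * edot w (delta_mx j 0) * edot w w)) =
     - (c * edot w (delta_mx j 0)).
    by rewrite /c; field; rewrite gt_eqF.
  by rewrite scaleNr opprK subrK !mxE eqxx andbT.
- rewrite HE.
  have -> : c * edot w a = 1.
    have e : 2 * edot w a = edot w w.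
      rewrite /w !(edotDl, edotDr, edotNl, edotNr) -ab (edotC b a); ring.
    by rewrite /c mulrAC e divff // gt_eqF.
  by rewrite scale1r /w opprB addrC subrK.
- move=> z zab; rewrite HE.
  by rewrite /w edotDl edotNl !(edotC _ z) zab subrr mulr0 scale0r subr0.
Qed.

End householder.

(** * A plane into which every pair of vectors can be rotated *)

Section frame.
Variables (R : realType) (n : nat).
Local Notation E := 'cV[R]_n.+1.

(** Asking only [edot e2 e2 <= 1] admits [e2 = 0], the choice made in dimension 1, which is thus
    treated together with the others. By [frame_fix], a vector fixed by the stabilizer of [e1] and
    [e2] lies in their span. *)
Record adapted_frame (e1 e2 : E) : Prop := AdaptedFrame {
  frame_unit : edot e1 e1 = 1;
  frame_orth : edot e1 e2 = 0;
  frame_le1 : edot e2 e2 <= 1;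
  frame_move : forall x y : E, y != 0 -> exists U : 'M[R]_n.+1,
    [/\ orthogonal_mx U, U *m y = enorm y *: e1 &
        U *m x = (edot x y / enorm y) *: e1 +
          Num.sqrt (enorm x ^+ 2 - (edot x y / enorm y) ^+ 2) *: e2];
  frame_flip : exists U : 'M[R]_n.+1,
    [/\ orthogonal_mx U, U *m e1 = e1 & U *m e2 = - e2];
  frame_fix : forall z : E,
    (forall U : 'M[R]_n.+1, orthogonal_mx U -> U *m e1 = e1 ->
       U *m e2 = e2 -> U *m z = z) ->
    z = edot z e1 *: e1 + edot z e2 *: e2 }.

Lemma edot_delta (x : E) i : edot x (delta_mx i 0) = x i ord0.
Proof.
rewrite /edot (bigD1 i) //= mxE !eqxx mulr1 big1 ?addr0 // => j /negPf ji.
by rewrite mxE ji mulr0.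
Qed.

Lemma exists_adapted_frame : exists e1 e2 : E, adapted_frame e1 e2.
Proof.
pose e1 : E := delta_mx ord0 0.
(* The dimension is [n.+1]: for [n = 0] there is no second direction, otherwise [ord_max] differs
   from [ord0]. *)
pose e2 : E := if n is 0 then 0 else delta_mx ord_max 0.
have e11 : edot e1 e1 = 1 by rewrite edot_delta mxE !eqxx.
have e12 : edot e1 e2 = 0.
  rewrite edotC edot_delta /e2; case: (n) => [|m]; first by rewrite mxE.
  by rewrite mxE.
have e2P : (n = 0%N /\ e2 = 0) \/ (exists2 i : 'I_n.+1, i != ord0 & e2 = delta_mx i 0).
  rewrite /e2; case: (n) => [|m]; [by left|right].
  by exists ord_max.
exists e1, e2; split => //.
- by case: e2P => [[_ ->]|[i _ ->]]; rewrite ?edot0l // edot_delta mxE !eqxx.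
- move=> x y y0; have ny := enorm_gt0 y0.
  have [U1 [UU1 U1y fix1]] : exists U : 'M[R]_n.+1, [/\ orthogonal_mx U,
      U *m y = enorm y *: e1 &
      forall z, edot z y = edot z (enorm y *: e1) -> U *m z = z].
    by apply: householder; rewrite edotZl edotZr e11 mulr1 -expr2 enorm_sqr.
  pose x1 := U1 *m x; set s := edot x y / enorm y.
  have sE : edot x1 e1 = s.
    rewrite /s -(edot_orthogonal x y UU1) U1y edotZr mulrC mulKf //.
    by rewrite gt_eqF.
  pose x2 := x1 - s *: e1.
  have x21 : edot x2 e1 = 0.
    by rewrite edotDl edotNl edotZl e11 mulr1 sE subrr.
  have xx : enorm x ^+ 2 - s ^+ 2 = edot x2 x2.
    rewrite enorm_sqr -(edot_orthogonal x x UU1) -/x1.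
    rewrite /x2 !(edotDl, edotDr, edotNl, edotNr, edotZl, edotZr) e11.
    rewrite (edotC e1) sE; ring.
  set t := Num.sqrt _.
  have tt : t ^+ 2 = edot x2 x2 by rewrite sqr_sqrtr // xx edot_ge0.
  have : edot x2 x2 = edot (t *: e2) (t *: e2).
    rewrite edotZl edotZr mulrA -expr2 tt.
    case: e2P => [[n0 e20]|[i i0 ->]].
      (* In dimension 1, [x2] is orthogonal to [e1], hence zero. *)
      rewrite e20 edot0l mulr0; apply/eqP; rewrite edot_eq0; apply/eqP/colP => i.
      have -> : i = ord0 by apply/val_inj; case: i => -[|m] //=; rewrite n0.
      by rewrite [RHS]mxE -x21 edot_delta.
    by rewrite edot_delta mxE !eqxx mulr1.
  move=> /householder[U2 [UU2 U2x fix2]].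
  (* Both [x2] and [t *: e2] are orthogonal to [e1], so the second reflection does not disturb the
     image of [y]. *)
  have U2e1 : U2 *m e1 = e1.
    by apply: fix2; rewrite edotC x21 edotZr e12 mulr0.
  exists (U2 *m U1); split; first exact: orthogonalM.
    by rewrite -mulmxA U1y -scalemxAr U2e1.
  by rewrite -mulmxA -/x1 -(subrK (s *: e1) x1) mulmxDr U2x -scalemxAr U2e1 addrC.
- have [U [oU Ue fixU]] : exists U : 'M[R]_n.+1, [/\ orthogonal_mx U, U *m e2 = - e2 &
      forall z, edot z e2 = edot z (- e2) -> U *m z = z].
    by apply: householder; rewrite edotNl edotNr opprK.
  exists U; split=> //; apply: fixU.
  by rewrite edotNr e12 oppr0.
move=> z fixz; apply/colP => i.
have [->|i0] := eqVneq i ord0.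
  rewrite !mxE edot_delta !eqxx mulr1.
  case: e2P => [[_ ->]|[k k0 ->]]; first by rewrite mxE mulr0 addr0.
  by rewrite mxE eq_sym (negPf k0) mulr0 addr0.
rewrite !mxE (negPf i0) mulr0 add0r.
case: e2P => [[n0 _]|[k k0 e2E]].
  have : (i <= n)%N by rewrite -ltnS ltn_ord.
  by move=> /leq_trans/(_ (eq_leq n0)); rewrite leqn0 => i00; move: i0; rewrite -val_eqE /= i00.
rewrite e2E edot_delta mxE eqxx andbT.
have [->|ik] := eqVneq i k; first by rewrite mulr1.
(* The reflection of another basis vector [e3] fixes [e1] and [e2], hence [z], whose coordinate
   along [e3] is then its own opposite. *)
rewrite mulr0; pose e3 : E := delta_mx i 0.
have [U [oU Ue fixU]] : exists U : 'M[R]_n.+1, [/\ orthogonal_mx U, U *m e3 = - e3 &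
    forall z, edot z e3 = edot z (- e3) -> U *m z = z].
  by apply: householder; rewrite edotNl edotNr opprK.
have fix0 (w : E) : w i ord0 = 0 -> U *m w = w.
  by move=> w0; apply: fixU; rewrite edotNr edot_delta w0 oppr0.
have /(congr1 (fun w => edot w (U *m e3))) : U *m z = z.
  apply: fixz => //; apply: fix0; rewrite ?e2E mxE.
    by rewrite (negPf i0).
  by rewrite (negPf ik).
by rewrite edot_orthogonal // Ue edotNr !edot_delta => /eqP; rewrite -addr_eq0 -mulr2n mulrn_eq0 => /eqP.
Qed.

End frame.

(** * Even and odd functions of sqrt (r - s ^ 2) *)

Section extension.
Variable R : realType.
Local Notation R2 := (R^o * R^o)%type.

Definition chart (s0 d : R) : set R2 :=
  [set p | `|p.2 - s0| < d /\ p.1 - p.2 ^+ 2 < d ^+ 2].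

Definition gap (p : R2) : R^o := p.1 - p.2 ^+ 2.

Lemma Ck_fst k (A : set R2) : Ck false k A (fst : R2 -> R^o).
Proof. by apply: Ck_linear => // x; exact: cvg_fst. Qed.

Lemma Ck_snd k (A : set R2) : Ck false k A (snd : R2 -> R^o).
Proof. by apply: Ck_linear => // x; exact: cvg_snd. Qed.

Lemma Ck_gap k (A : set R2) : open A -> Ck false k A gap.
Proof.
move=> oA; apply: (eq_Ck oA)
  (CkB oA (Ck_fst k A) (CkM oA (Ck_snd k A) (Ck_snd k A))) => x _.
by rewrite /gap expr2.
Qed.

Lemma continuous_gap : continuous gap.
Proof.
move=> p; apply: differentiable_continuous.
by have [+ _ _] := Ck_gap 0 openT; exact.
Qed.

Lemma open_chart s0 d : open (chart s0 d).
Proof.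
have -> : chart s0 d = snd @^-1` ball (s0 : R^o) d `&` gap @^-1` [set x : R^o | x < d ^+ 2].
  by apply/seteqP; split=> p; rewrite /chart /ball /= distrC.
apply: openI; apply: open_comp.
- by move=> p _; exact: cvg_snd.
- exact: ball_open.
- by move=> p _; exact: continuous_gap.
- exact: open_lt.
Qed.

(** The argument is [tau ^ 2 = v / (d ^ 2 - v)] with [v = gap p]: it is smooth on the whole chart,
    where [gap] also takes negative values. *)
Lemma Ck_chart k s0 d (K : R2 -> R^o) : even_bsmooth s0 d K ->
  Ck false k (chart s0 d)
    (fun p => sqrt_ext 0 K (p.2, gap p * rsqrt (d ^+ 2 - gap p) ^+ 2)).
Proof.
move=> eK; have oC := @open_chart s0 d.
have Cg := Ck_gap k oC.
have Cr : Ck false k (chart s0 d) (fun p => rsqrt (d ^+ 2 - gap p)).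
  apply: Ck_rsqrt => //; first by move=> x [_ xd]; rewrite subr_gt0.
  by apply: CkB => //; exact: Ck_cst.
apply: (Ck_comp oC _ (sqrt_ext_Ck k 0 eK) (Ck_snd k _)); first by move=> x [].
exact: (CkM oC Cg (CkM oC Cr Cr)).
Qed.

Lemma sqrt_rsqrt (u c : R) : 0 < c ->
  Num.sqrt (u * rsqrt c ^+ 2) = Num.sqrt u * rsqrt c.
Proof.
move=> c0; rewrite mulrC sqrtrM ?sqr_ge0 // sqrtr_sqr gtr0_norm ?rsqrt_gt0 //.
by rewrite mulrC.
Qed.

(** Inverts the substitution: for [tau ^ 2 = u / (d ^ 2 - u)] one has
    [1 + tau ^ 2 = d ^ 2 / (d ^ 2 - u)]. *)
Lemma sinarctan_rsqrt (d u : R) : 0 < d -> 0 <= u -> u < d ^+ 2 ->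
  d * sinarctan (Num.sqrt u * rsqrt (d ^+ 2 - u)) = Num.sqrt u.
Proof.
move=> d0 u0 ud; have c0 : 0 < d ^+ 2 - u by rewrite subr_gt0.
rewrite /sinarctan /cosarctan exprMn rsqrt_sqr // sqr_sqrtr //.
have -> : 1 + u / (d ^+ 2 - u) = (d * rsqrt (d ^+ 2 - u)) ^+ 2.
  by rewrite exprMn rsqrt_sqr //; field; rewrite gt_eqF.
have r0 := rsqrt_gt0 c0; move: (rsqrt (d ^+ 2 - u)) r0 => r r0.
rewrite /rsqrt sqrtr_sqr gtr0_norm ?mulr_gt0 //.
by field; rewrite !gt_eqF.
Qed.

Lemma sinarctanN (t : R) : sinarctan (- t) = - sinarctan t.
Proof. by rewrite /sinarctan /cosarctan sqrrN mulNr. Qed.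

(* [K (s, tau) = A (s, d sin (arctan tau))] has bounded derivatives on a whole
   strip as soon as [A] is smooth near the box of half-width [d]. *)
Lemma bsmooth_arctan (A : R2 -> R^o) (D : set R2) (s0 d : R) : 0 < d ->
  (forall k, Ck false k D A) ->
  (forall s t, `|s - s0| <= d -> `|t| <= d -> D (s, t)) ->
  bsmooth s0 d (fun p => A (p.1, d * sinarctan p.2)).
Proof.
move=> d0 CA box k; have os := @open_strip R s0 d.
pose Q : set R2 := `[s0 - d, s0 + d]%classic `*` `[- d, d]%classic.
pose Q0 : set R2 := [set p | `|p.1 - s0| < d /\ `|p.2| < d].
have cQ : compact Q by apply: compact_setX; exact: segment_compact.
have QD : Q `<=` D.
  move=> [s t] [/=]; rewrite !in_itv /= -ler_distlC -ler_norml distrC => hs ht.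
  exact: box.
have Q0Q : Q0 `<=` Q.
  move=> [s t] [/= hs ht]; split=> /=; rewrite in_itv /=.
    by rewrite -ler_distlC distrC ltW.
  by rewrite -ler_norml ltW.
have CQ l : Ck false l Q A by exact: Ck_subset QD (CA l).
have CQ0 := Ck_compact Q0Q cQ (CQ k).
apply: (Ck_comp os _ CQ0).
- move=> x sx; split=> //=; rewrite normrM (gtr0_norm d0).
  by rewrite gtr_pMr // sinarctan_le1.
- apply: Ck_linear; first by move=> x; exact: cvg_fst.
  move=> _; exists (`|s0| + d) => x sx.
  have h : `|x.1| <= `|s0| + d; last exact: h.
  by rewrite -(subrK s0 x.1) (le_trans (ler_normD _ _)) // addrC lerD2l ltW.
- by apply: CkZ => //; have [] := Ck_arctan k os.
Qed.

Lemma exists_box (s0 e : R) : 0 < e -> exists2 d : R, 0 < d &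
  forall s t, `|s - s0| <= d -> `|t| <= d -> s ^+ 2 + t ^+ 2 < s0 ^+ 2 + e.
Proof.
move=> e0; pose m := 2 * `|s0| + 2.
have m0 : 0 < m by rewrite ltr_wpDl // mulr_ge0.
exists (Num.min 1 (e / (2 * m))).
  by rewrite lt_min ltr01 divr_gt0 // mulr_gt0.
move=> s t; rewrite !le_min => /andP[s1 s2] /andP[t1 t2].
have h : 2 * `|s0| * `|s - s0| + `|s - s0| ^+ 2 + `|t| ^+ 2 < e.
  move: s2 t2; rewrite !ler_pdivlMr ?mulr_gt0 // /m.
  move: (normr_ge0 s0) (normr_ge0 (s - s0)) (normr_ge0 t) s1 t1.
  move: `|s0| `|s - s0| `|t| => x y z x0 y0 z0 y1 z1 ym zm.
  have yy : y ^+ 2 <= y by rewrite expr2 ler_piMr.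
  have zz : z ^+ 2 <= z by rewrite expr2 ler_piMr.
  have zx : 0 <= z * x by rewrite mulr_ge0.
  have yx : 0 <= y * x by rewrite mulr_ge0.
  nra.
have -> : s ^+ 2 = s0 ^+ 2 + 2 * s0 * (s - s0) + (s - s0) ^+ 2 by ring.
rewrite -!addrA ltrD2l (le_lt_trans _ h) // -addrA.
rewrite !real_normK ?num_real // lerD2r.
by rewrite (le_trans (ler_norm _)) // !normrM (ger0_norm (ler0n _ 2)).
Qed.

Variables (D : set R2) (r0 s0 : R).
Hypothesis s0r0 : s0 ^+ 2 <= r0.
Hypothesis near_D : exists2 e : R, 0 < e &
  forall s t, s ^+ 2 + t ^+ 2 < r0 + e -> D (s, t).

(** Agreement is asked only where [s ^ 2 <= r], a region containing all the values of [rs]. *)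
Definition locally_smooth_ext (f : R2 -> R^o) := exists (O : set R2) (g : R2 -> R^o),
  [/\ open O, O (r0, s0), forall k, Ck false k O g &
      forall p, O p -> p.2 ^+ 2 <= p.1 -> g p = f p].

(** Where [s ^ 2 < r] the square root of [gap] is itself smooth and the given formula is its own
    extension. *)
Lemma interior_chart : s0 ^+ 2 < r0 -> exists O : set R2, [/\ open O, O (r0, s0),
  forall p, O p -> D (p.2, Num.sqrt (gap p)) & forall p, O p -> 0 < gap p].
Proof.
move=> sr; have [e e0 eD] := near_D.
exists ([set p : R2 | 0 < gap p] `&` [set p : R2 | p.1 < r0 + e]); split.
- apply: openI.
    apply: (@open_comp _ _ gap [set x : R^o | 0 < x]); last exact: open_gt.
    by move=> p _; exact: continuous_gap.
  apply: (@open_comp _ _ (fst : R2 -> R^o) [set x : R^o | x < r0 + e]).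
    by move=> p _; exact: cvg_fst.
  exact: open_lt.
- by split; rewrite /= ?subr_gt0 // ltrDl.
- move=> p [/= gp pe]; apply: eD; rewrite sqr_sqrtr ?(ltW gp) //.
  by rewrite /gap addrC subrK.
- by move=> p [].
Qed.

Lemma Ck_sqrt_gap k (O : set R2) : open O -> (forall p, O p -> 0 < gap p) ->
  Ck false k O (fun p => Num.sqrt (gap p)) /\ Ck false k O (fun p => rsqrt (gap p)).
Proof.
move=> oO gO; have Cg := Ck_gap k oO.
have Cr : Ck false k O (fun p => rsqrt (gap p)) by exact: Ck_rsqrt.
split=> //; apply: (eq_Ck oO) (CkM oO Cg Cr) => p Op.
rewrite /rsqrt -{1}(@sqr_sqrtr _ (gap p)) ?(ltW (gO _ Op)) // expr2 mulfK //.
by rewrite gt_eqF // sqrtr_gt0 gO.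
Qed.

Lemma even_ext (A : R2 -> R^o) : (forall k, Ck false k D A) ->
  (forall s t, D (s, t) -> A (s, - t) = A (s, t)) ->
  locally_smooth_ext (fun p => A (p.2, Num.sqrt (gap p))).
Proof.
move=> CA Aeven; case: (ltrP (s0 ^+ 2) r0) => [sr|rs].
  have [N [oN Np ND Ng]] := interior_chart sr.
  exists N, (fun p => A (p.2, Num.sqrt (gap p))); split=> // k.
  by apply: (Ck_comp oN ND (CA k) (Ck_snd k N)); have [] := Ck_sqrt_gap k oN Ng.
have r0E : r0 = s0 ^+ 2 by apply/le_anti; rewrite rs s0r0.
have [e e0 eD] := near_D; have [d d0 dP] := exists_box s0 e0.
have box s t : `|s - s0| <= d -> `|t| <= d -> D (s, t).
  by move=> hs ht; apply: eD; rewrite r0E; exact: dP.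
pose K : R2 -> R^o := fun p => A (p.1, d * sinarctan p.2).
have eK : even_bsmooth s0 d K.
  split; first exact: bsmooth_arctan d0 CA box.
  move=> p sp; rewrite /K /= sinarctanN mulrN Aeven //; apply: box; first exact: ltW.
  by rewrite normrM (gtr0_norm d0) ler_piMr ?ltW ?sinarctan_le1.
exists (chart s0 d), (fun p => sqrt_ext 0 K (p.2, gap p * rsqrt (d ^+ 2 - gap p) ^+ 2)).
split.
- exact: open_chart.
- by split; rewrite /= ?subrr ?normr0 // r0E subrr exprn_gt0.
- by move=> k; exact: Ck_chart.
move=> p [ps pd] pp; have g0 : 0 <= gap p by rewrite subr_ge0.
have c0 : 0 < d ^+ 2 - gap p by rewrite subr_gt0.
rewrite sqrt_ext_ge0 /=; last by rewrite mulr_ge0 // sqr_ge0.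
by rewrite /K /= sqrt_rsqrt // sinarctan_rsqrt.
Qed.

(** [B / t], with its limit as value at [t = 0], where an odd [B] vanishes. Where [gap] is negative,
    [Num.sqrt] is 0 and the first branch is a default value. *)
Definition odd_quotient (B : R2 -> R^o) : R2 -> R^o := fun p =>
  let t := Num.sqrt (gap p) in
  if t == 0 then 'D_(0, 1) B (p.2, 0) else B (p.2, t) / t.

(** At a point with [r0 = s0 ^ 2], Hadamard's lemma in the variable [tau] writes [K] as [tau * b]
    with [b] even. Then [B / t] is [b * (tau / t)], and [tau / t] is [rsqrt (d ^+ 2 - gap p)]. *)
Lemma odd_ext (B : R2 -> R^o) : (forall k, Ck false k D B) ->
  (forall s t, D (s, t) -> B (s, - t) = - B (s, t)) ->
  locally_smooth_ext (odd_quotient B).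
Proof.
move=> CB Bodd; case: (ltrP (s0 ^+ 2) r0) => [sr|rs].
  have [N [oN Np ND Ng]] := interior_chart sr.
  exists N, (fun p => B (p.2, Num.sqrt (gap p)) * rsqrt (gap p)); split=> // [k|p Npp _].
    have [Cs Cr] := Ck_sqrt_gap k oN Ng.
    by apply: CkM => //; exact: (Ck_comp oN ND (CB k) (Ck_snd k N)).
  by rewrite /odd_quotient /= gt_eqF // sqrtr_gt0 Ng.
have r0E : r0 = s0 ^+ 2 by apply/le_anti; rewrite rs s0r0.
have [e e0 eD] := near_D; have [d d0 dP] := exists_box s0 e0.
have box s t : `|s - s0| <= d -> `|t| <= d -> D (s, t).
  by move=> hs ht; apply: eD; rewrite r0E; exact: dP.
pose K : R2 -> R^o := fun p => B (p.1, d * sinarctan p.2).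
have bK : bsmooth s0 d K by exact: bsmooth_arctan d0 CB box.
have oK p : strip s0 d p -> K (p.1, - p.2) = -1 * K p.
  move=> sp; rewrite /K /= sinarctanN mulrN Bodd ?mulN1r //; apply: box; first exact: ltW.
  by rewrite normrM (gtr0_norm d0) ler_piMr ?ltW ?sinarctan_le1.
have K0 s : strip s0 d (s, 0) -> K (s, 0) = 0.
  move=> ss; have := oK (s, 0) ss; rewrite /= oppr0 mulN1r => /eqP.
  by rewrite -addr_eq0 -mulr2n mulrn_eq0 => /eqP.
have dK p : strip s0 d p -> differentiable K p by exact: bsmooth_diff.
pose b := smear (@unit_integral R) 0 ('D_(0, 1) K).
have eb : even_bsmooth s0 d b.
  split.
    apply: bsmooth_smear; first exact: averaging_unit_integral.
    exact: bsmooth_derive.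
  move=> p sp; apply: eq_smear => l.
  rewrite -[LHS]/('D_(0, 1) K (p.1, l * - p.2)) mulrN.
  have [_] := derive_parity dK oK (sp : strip s0 d (p.1, l * p.2)).
  by rewrite opprK mul1r.
exists (chart s0 d), (fun p => sqrt_ext 0 b (p.2, gap p * rsqrt (d ^+ 2 - gap p) ^+ 2)
   * rsqrt (d ^+ 2 - gap p)).
split.
- exact: open_chart.
- by split; rewrite /= ?subrr ?normr0 // r0E subrr exprn_gt0.
- move=> k; have oC := @open_chart s0 d; apply: CkM => //; first exact: Ck_chart.
  apply: Ck_rsqrt => //; first by move=> x [_ xd]; rewrite subr_gt0.
  by apply: CkB => //; [exact: Ck_cst|exact: Ck_gap].
move=> p [ps pd] pp; have g0 : 0 <= gap p by rewrite subr_ge0.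
have c0 : 0 < d ^+ 2 - gap p by rewrite subr_gt0.
rewrite sqrt_ext_ge0 /=; last by rewrite mulr_ge0 // sqr_ge0.
rewrite sqrt_rsqrt // /odd_quotient /=.
case: eqVneq => [t0|t0].
  have gp0 : gap p = 0 by move/eqP: t0; rewrite sqrtr_eq0 => gle; apply/le_anti; rewrite gle.
  have sp0 : strip s0 d (p.2, 0) by [].
  (* On the curve [gap = 0] the value is compared by the chain rule: [d * sinarctan] has derivative
     [d] at 0, which [rsqrt (d ^+ 2)] cancels. *)
  have bE : b (p.2, 0) = 'D_(0, 1) K (p.2, 0).
    rewrite /b /smear /=.
    rewrite (_ : (fun l => _) = fun=> 'D_(0, 1) K (p.2, 0)) ?unit_integral_cst //.
    by apply/funext => l; rewrite expr0 mul1r mulr0.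
  rewrite t0 mul0r bE gp0 subr0.
  have dB : differentiable B (p.2, d * sinarctan 0).
    have [+ _ _] := CB 0; apply; apply: box; first exact: ltW.
    by rewrite /sinarctan mul0r mulr0 normr0 ltW.
  have ds : is_derive (0 : R^o) 1 (fun t : R^o => d * sinarctan t : R^o) (d * cosarctan 0 ^+ 3).
    exact: (is_deriveZ d (is_derive_sinarctan 0)).
  have dd := @is_derive1_comp R (fun t => B (p.2, t)) (fun t => d * sinarctan t) 0 _ _
    (is_derive_snd dB) ds.
  have dK0 := is_derive_snd (dK _ sp0).
  have -> : 'D_(0, 1) K (p.2, 0) = 'D_(0, 1) B (p.2, d * sinarctan 0) * (d * cosarctan 0 ^+ 3).
    by rewrite -(@derive_val _ _ _ _ _ _ _ dK0) -(@derive_val _ _ _ _ _ _ _ dd).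
  have -> : d * sinarctan 0 = 0 by rewrite /sinarctan mul0r mulr0.
  have -> : cosarctan 0 = 1 :> R by rewrite /cosarctan expr0n addr0 /rsqrt sqrtr1 invr1.
  rewrite expr1n mulr1 /rsqrt sqrtr_sqr gtr0_norm // -mulrA divff ?mulr1 //.
  by rewrite gt_eqF.
have sp : strip s0 d (p.2, Num.sqrt (gap p) * rsqrt (d ^+ 2 - gap p)) by [].
have := hadamard bK K0 sp; rewrite /= -/b.
rewrite {1}/K /= sinarctan_rsqrt // => ->.
by move: (b _) => u; field.
Qed.

End extension.

(** * Spherically symmetric sprays *)

Section symmetric_sprays.
Variables (R : realType) (n : nat).
Local Notation E := 'cV[R]_n.
Local Notation TE := (E * E)%type.

Lemma continuous_mulmx (U : 'M[R]_n) : continuous (fun x : E => U *m x).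
Proof.
have -> : (fun x : E => U *m x) = (fun x : E => \sum_j x j ord0 *: col j U).
  apply/funext => x; apply/colP => i; rewrite summxE mxE; apply: eq_bigr => j _.
  by rewrite !mxE mulrC.
move=> x; apply: differentiable_continuous.
have -> : (fun x : E => \sum_j x j ord0 *: col j U) =
    \sum_j (fun x : E => x j ord0 *: col j U).
  by apply/funext => y; rewrite fct_sumE.
apply: differentiable_sum => j.
by apply: differentiableZl; exact: differentiable_coord.
Qed.

Lemma diff_Psi (U : 'M[R]_n) (p : TE) : 'd (Psi U) p = Psi U :> (TE -> TE).
Proof.
have lP : linear (Psi U).
  by move=> a x y; rewrite /Psi /= !mulmxDr -!scalemxAr.
pose lL := GRing.isLinear.Build _ _ _ _ (Psi U) lP.
pose L : {linear TE -> TE} := HB.pack (Psi U) lL.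
apply: (@diff_lin R TE TE L) => q.
have c1 : (fun q : TE => U *m q.1) @ q --> U *m q.1.
  apply: (@continuous_comp TE E E fst (fun x => U *m x)); first exact: cvg_fst.
  exact: continuous_mulmx.
have c2 : (fun q : TE => U *m q.2) @ q --> U *m q.2.
  apply: (@continuous_comp TE E E snd (fun x => U *m x)); first exact: cvg_snd.
  exact: continuous_mulmx.
exact: (cvg_pair c1 c2).
Qed.

Lemma enorm_orthogonal (U : 'M[R]_n) x : orthogonal_mx U -> enorm (U *m x) = enorm x.
Proof. by move=> UU; rewrite /enorm edot_orthogonal. Qed.

Lemma mulmx_orthogonal_eq0 (U : 'M[R]_n) (x : E) : orthogonal_mx U ->
  (U *m x == 0) = (x == 0).
Proof. by move=> UU; rewrite -!edot_eq0 edot_orthogonal. Qed.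

(** What is used of the domain, for balls and the whole space alike: membership is an open, downward
    closed condition on [|x| ^ 2]. *)
Lemma radial_domain (Omega : set E) : centered_ball_or_space Omega ->
  exists W : R -> Prop, (forall x, Omega x <-> W (edot x x)) /\
    forall r, W r -> exists2 e : R, 0 < e & forall r', r' < r + e -> W r'.
Proof.
move=> [[rho rho0 ->]|->]; last by exists (fun=> True); split=> // r _; exists 1.
exists (fun r => r < rho ^+ 2); split=> [x|r rr].
  by rewrite /= -enorm_sqr ltr_pXn2r // ?nnegrE ?enorm_ge0 // ltW.
by exists (rho ^+ 2 - r); [rewrite subr_gt0|move=> r'; rewrite addrC subrK].
Qed.

(** [Psi U] is linear, hence its own differential. The first component of the push-forward always
    agrees with that of the spray field; the second one carries the condition on [G]. *)
Lemma invariance (Omega : set E) (G : TE -> E) :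
  centered_ball_or_space Omega ->
  spherically_symmetric Omega G <->
  (forall (U : 'M[R]_n) (x y : E), orthogonal_mx U -> Omega x -> y != 0 ->
    G (U *m x, U *m y) = U *m G (x, y)).
Proof.
move=> /radial_domain[W [WP _]]; split=> [sG U x y UU Ox y0|invG U UU q].
  have uU := orthogonal_unit UU.
  have /(sG U UU) : (U *m x, U *m y) \in slit_tangent Omega.
    apply/mem_set; split; last by rewrite mulmx_orthogonal_eq0.
    by apply/WP; rewrite edot_orthogonal //; apply/WP.
  rewrite /push_field diff_Psi /Psi /spray_field /= !mulKmx // => -[].
  by rewrite mulmxN -scalemxAr => /oppr_inj/scalerI ->.
rewrite inE => -[Oq q0]; have uU := orthogonal_unit UU.
have VV := orthogonalV UU.
rewrite /push_field diff_Psi /Psi /spray_field /= mulKVmx //.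
rewrite mulmxN -scalemxAr -invG ?mulKVmx //; first by case: (q).
  by apply/WP; rewrite edot_orthogonal //; apply/WP.
by rewrite mulmx_orthogonal_eq0.
Qed.

Lemma iter_derive_affine (V V' Z : normedModType R) (f : V -> Z) (h l : V' -> V) vs :
  (forall (t : R) v x, h (t *: v + x) = t *: l v + h x) ->
  iter_derive vs (f \o h) = iter_derive (map l vs) f \o h.
Proof.
move=> hl; elim: vs => [//|v vs IH] /=.
by rewrite IH; apply/funext => x; exact: derive_affine.
Qed.

(** Used to restrict [G] to a plane of points [x] with [y] frozen; along an affine map iterated
    derivatives pull back one by one. *)
Lemma smooth_on_affine (V V' Z : normedModType R) (A : set V) (f : V -> Z)
    (h l : V' -> V) :
  (forall (t : R) v x, h (t *: v + x) = t *: l v + h x) ->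
  (forall x, differentiable h x) -> smooth_on A f ->
  smooth_on (h @^-1` A) (f \o h).
Proof.
move=> hl dh sf vs x Ahx; rewrite (iter_derive_affine _ _ hl).
by apply: differentiable_comp => //; exact: sf.
Qed.

End symmetric_sprays.

(** * Restriction of the spray to a plane *)

Section planar_components.
Variables (R : realType) (n : nat) (Omega : set 'cV[R]_n) (e1 e2 w : 'cV[R]_n).
Variable G : 'cV[R]_n * 'cV[R]_n -> 'cV[R]_n.
Local Notation R2 := (R^o * R^o)%type.

Definition planar (q : R2) : 'cV[R]_n * 'cV[R]_n := (q.1 *: e1 + q.2 *: e2, e1).

Definition planar_comp (q : R2) : R^o := edot (G (planar q)) w.

Lemma differentiable_planar q : differentiable planar q.
Proof.
apply: differentiable_pair; last exact: differentiable_cst.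
by apply: differentiableD; apply: differentiableZl; apply: linear_differentiable => x;
  [exact: cvg_fst|exact: cvg_snd].
Qed.

Lemma planar_affine (t : R) (v x : R2) :
  planar (t *: v + x) = t *: ((v.1 *: e1 + v.2 *: e2, 0) : 'cV[R]_n * 'cV[R]_n) + planar x.
Proof.
rewrite /planar; apply: injective_projections => /=; last by rewrite scaler0 add0r.
by rewrite !scalerDl scalerDr !scalerA addrACA.
Qed.

Lemma Ck_planar_comp k : e1 != 0 ->
  (forall i : 'I_n, smooth_on (slit_tangent Omega) (fun p => G p i ord0 : R^o)) ->
  open [set q : R2 | Omega (q.1 *: e1 + q.2 *: e2)] ->
  Ck false k [set q : R2 | Omega (q.1 *: e1 + q.2 *: e2)] planar_comp.
Proof.
move=> e10 sG oD; rewrite /planar_comp /edot.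
apply: Ck_sum => // i; apply: CkM => //; last exact: Ck_cst.
have := smooth_on_affine (fun t v x => planar_affine t v x) differentiable_planar (sG i).
move=> /smooth_onP/(_ k); congr (Ck _ _ _ _).
by apply/seteqP; split=> q /=; rewrite /slit_tangent /=; [case|split].
Qed.

End planar_components.

(** * The representation formula and the smoothness of its coefficients *)

Section representation.
Variables (R : realType) (n : nat) (Omega : set 'cV[R]_n.+1).
Variable G : 'cV[R]_n.+1 * 'cV[R]_n.+1 -> 'cV[R]_n.+1.
Local Notation R2 := (R^o * R^o)%type.
Local Notation E := 'cV[R]_n.+1.

Hypothesis OmegaP : centered_ball_or_space Omega.
Hypothesis sprayG : is_spray Omega G.
Hypothesis invG : forall (U : 'M[R]_n.+1) (x y : E), orthogonal_mx U -> Omega x ->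
  y != 0 -> G (U *m x, U *m y) = U *m G (x, y).
Variables e1 e2 : E.
Hypothesis frame : adapted_frame e1 e2.

Let D : set R2 := [set q | Omega (q.1 *: e1 + q.2 *: e2)].
Let A := planar_comp e1 e2 e1 G.
Let B := planar_comp e1 e2 e2 G.

Lemma frame_neq0 : e1 != 0.
Proof. by rewrite -edot_eq0 (frame_unit frame) oner_eq0. Qed.

Lemma edot_planar (s t : R) :
  edot (s *: e1 + t *: e2) (s *: e1 + t *: e2) = s ^+ 2 + t ^+ 2 * edot e2 e2.
Proof.
rewrite !(edotDl, edotDr, edotZl, edotZr) (edotC e2 e1) (frame_orth frame).
rewrite (frame_unit frame); ring.
Qed.

Lemma edot_planar_le (s t : R) :
  edot (s *: e1 + t *: e2) (s *: e1 + t *: e2) <= s ^+ 2 + t ^+ 2.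
Proof.
by rewrite edot_planar lerD2l ler_piMr ?sqr_ge0 // (frame_le1 frame).
Qed.

Lemma near_planar_domain x : Omega x -> exists2 e : R, 0 < e &
  forall s t, s ^+ 2 + t ^+ 2 < enorm x ^+ 2 + e -> D (s, t).
Proof.
have [W [WP We]] := radial_domain OmegaP => /WP/We[e e0 eW]; exists e => // s t.
rewrite enorm_sqr => st; apply/WP/eW; apply: le_lt_trans st.
exact: edot_planar_le.
Qed.

Lemma open_planar_domain : open D.
Proof.
have [W [WP We]] := radial_domain OmegaP.
pose f (q : R2) : R := q.1 ^+ 2 + q.2 ^+ 2 * edot e2 e2.
have -> : D = f @^-1` [set r | W r].
  apply/seteqP; split=> q; rewrite /D /f /= -edot_planar; first by move/WP.
  by move=> Wq; apply/WP.
apply: open_comp.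
  move=> q _; rewrite /f; apply: (@cvgD _ R^o).
    by apply: (@continuous_comp R2 R R fst (fun u => u ^+ 2));
      [exact: cvg_fst|exact: exprn_continuous].
  apply: cvgM; last exact: cvg_cst.
  by apply: (@continuous_comp R2 R R snd (fun u => u ^+ 2));
    [exact: cvg_snd|exact: exprn_continuous].
rewrite openE => r /We[e e0 eW]; apply/nbhs_ballP; exists e => // r'.
rewrite /ball /= => rr'; apply: eW; rewrite -ltrBlDl.
by rewrite (le_lt_trans (ler_norm _)) // distrC.
Qed.

Lemma Ck_planar k w : Ck false k D (planar_comp e1 e2 w G).
Proof.
have [sG _ _] := sprayG.
by apply: Ck_planar_comp => //; [exact: frame_neq0|exact: open_planar_domain].
Qed.

(** Leaving [w] free gives both parities: the flip fixes [w = e1] and negates [w = e2]. *)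
Lemma planar_flip w s t : D (s, t) -> exists U : 'M[R]_n.+1,
  [/\ orthogonal_mx U, U *m e1 = e1, U *m e2 = - e2 &
  planar_comp e1 e2 (U *m w) G (s, - t) = planar_comp e1 e2 w G (s, t)].
Proof.
have [U [UU U1 U2]] := frame_flip frame => Dst; exists U; split=> //.
rewrite /planar_comp /planar /=.
have -> : s *: e1 + - t *: e2 = U *m (s *: e1 + t *: e2).
  by rewrite mulmxDr -!scalemxAr U1 U2 scalerN scaleNr.
by have := invG UU Dst frame_neq0; rewrite U1 => ->; rewrite edot_orthogonal.
Qed.

Lemma A_even s t : D (s, t) -> A (s, - t) = A (s, t).
Proof. by move=> /(planar_flip e1)[U [_ U1 _]]; rewrite U1. Qed.

Lemma B_odd s t : D (s, t) -> B (s, - t) = - B (s, t).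
Proof.
move=> /(planar_flip e2)[U [_ _ U2]]; rewrite U2 => BE.
by rewrite /B -BE /planar_comp edotNr opprK.
Qed.

(** An orthogonal map fixing [e1] and [e2] fixes the argument of [G], hence by invariance its
    value. *)
Lemma planar_decomposition s t : D (s, t) ->
  G (s *: e1 + t *: e2, e1) = A (s, t) *: e1 + B (s, t) *: e2.
Proof.
move=> Dst; apply: (frame_fix frame) => U UU U1 U2.
rewrite -invG //; last exact: frame_neq0.
by rewrite mulmxDr -!scalemxAr U1 U2.
Qed.

Definition spray_beta : R2 -> R^o := odd_quotient B.
(** Comes from substituting [t e2 = U x - s e1] in [A e1 + B e2]. *)
Definition spray_alpha : R2 -> R^o :=
  fun p => A (p.2, Num.sqrt (gap p)) - p.2 * spray_beta p.

(** Cauchy-Schwarz, read off the frame: [s] is the coordinate of [U *m x] along [e1]. *)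
Lemma rs_le (x y : E) : y != 0 -> (edot x y / enorm y) ^+ 2 <= enorm x ^+ 2.
Proof.
move=> y0; have [U [UU _ Ux]] := frame_move frame x y0.
rewrite (enorm_sqr x) -(edot_orthogonal x x UU) Ux edot_planar.
by rewrite lerDl mulr_ge0 ?sqr_ge0 // edot_ge0.
Qed.

Lemma representation x y : Omega x -> y != 0 ->
  G (x, y) = (enorm y * spray_alpha (rs (x, y))) *: y +
             (enorm y ^+ 2 * spray_beta (rs (x, y))) *: x.
Proof.
move=> Ox y0; have [U [UU Uy Ux]] := frame_move frame x y0.
have [_ hG _] := sprayG; have uU := orthogonal_unit UU.
have ny := enorm_gt0 y0; have ny0 : enorm y != 0 by rewrite gt_eqF.
have OUx : Omega (U *m x).
  have [W [WP _]] := radial_domain OmegaP.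
  by apply/WP; rewrite edot_orthogonal //; apply/WP.
move: Ux OUx; set s := edot x y / enorm y; set t := Num.sqrt _ => Ux OUx.
have Dst : D (s, t) by rewrite /D /= -Ux.
have tE : Num.sqrt (gap (rs (x, y))) = t by [].
(* For [t = 0] oddness gives [B (s, 0) = 0] and both sides vanish, whatever the value of
   [spray_beta]. *)
have Bt : B (s, t) *: e2 = spray_beta (rs (x, y)) *: (t *: e2).
  rewrite /spray_beta /odd_quotient tE /= -/s; case: eqVneq => [t0|t0]; last first.
    by rewrite scalerA divfK.
  have := B_odd Dst; rewrite t0 oppr0 => /eqP; rewrite -addr_eq0 -mulr2n mulrn_eq0 /=.
  by move=> /eqP ->; rewrite !scale0r scaler0.
(* The two sides are compared after applying [U], where homogeneity takes [enorm y ^+ 2] out of [G]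
   and leaves its value at [e1]. *)
apply: (can_inj (mulKmx uU)); rewrite -invG // Uy hG // Ux planar_decomposition //.
have -> : A (s, t) = spray_alpha (rs (x, y)) + s * spray_beta (rs (x, y)).
  by rewrite /spray_alpha tE subrK.
rewrite Bt mulmxDr -!scalemxAr Uy Ux -/s -/t.
move: (spray_alpha _) (spray_beta _) => a b.
rewrite !scalerDr !scalerDl !scalerDr !scalerA addrA.
by congr (_ + _ + _); congr (_ *: _); ring.
Qed.

Lemma smooth_spray_beta : smooth_rel (@rs R n.+1 @` slit_tangent Omega) spray_beta.
Proof.
move=> _ [[x y] [/= Ox y0] <-].
have [N [g [oN Np Cg gE]]] := odd_ext (rs_le x y0) (near_planar_domain Ox)
  (fun k => Ck_planar k e2) B_odd.
exists N, g; split=> //; first exact/smooth_onP.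
move=> p; rewrite inE => -[Npp [[x' y'] [/= _ y'0] pE]].
by apply: gE => //; rewrite -pE /= rs_le.
Qed.

Lemma smooth_spray_alpha : smooth_rel (@rs R n.+1 @` slit_tangent Omega) spray_alpha.
Proof.
move=> _ [[x y] [/= Ox y0] <-].
have [N [g [oN Np Cg gE]]] := odd_ext (rs_le x y0) (near_planar_domain Ox)
  (fun k => Ck_planar k e2) B_odd.
have [M [f [oM Mp Cf fE]]] := even_ext (rs_le x y0) (near_planar_domain Ox)
  (fun k => Ck_planar k e1) A_even.
have oMN : open (M `&` N) by exact: openI.
exists (M `&` N), (fun p => f p - p.2 * g p); split=> //.
  apply/smooth_onP => k; apply: CkB => //.
    by apply: Ck_subset (Cf k) => p [].
  apply: CkM => //; first exact: Ck_snd.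
  by apply: Ck_subset (Cg k) => p [].
move=> p; rewrite inE => -[[Mpp Npp] [[x' y'] [/= _ y'0] pE]].
have pp : p.2 ^+ 2 <= p.1 by rewrite -pE /= rs_le.
by rewrite /spray_alpha fE // gE.
Qed.

End representation.

Unset Implicit Arguments.
Set Strict Implicit.

Theorem theorem1p1 (R : realType) (n : nat) (Omega : set 'cV[R]_n)
    (G : 'cV[R]_n * 'cV[R]_n -> 'cV[R]_n) :
  centered_ball_or_space Omega ->
  is_spray Omega G ->
  spherically_symmetric Omega G <->
  exists alpha beta : R^o * R^o -> R^o,
    [/\ smooth_rel (@rs R n @` slit_tangent Omega) alpha,
        smooth_rel (@rs R n @` slit_tangent Omega) beta,
        forall x y : 'cV[R]_n, Omega x -> y != 0 -> forall i : 'I_n,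
          G (x, y) i ord0 =
            enorm y * alpha (enorm x ^+ 2, edot x y / enorm y) * y i ord0 +
            enorm y ^+ 2 * beta (enorm x ^+ 2, edot x y / enorm y) * x i ord0
      & forall x : 'cV[R]_n, Omega x -> forall i : 'I_n, G (x, 0) i ord0 = 0].
Proof.
move=> OP sG; rewrite (invariance G OP); split=> [|[alpha [beta [_ _ GE _]]] U x y UU Ox y0].
  have [_ _ zG] := sG.
  case: n => [|m] in Omega G OP sG zG * => invG.
    (* In dimension 0 there is no [y != 0], so every condition is void. *)
    have noy (y : 'cV[R]_0) : y = 0 by apply/colP => -[].
    exists (fun=> 0), (fun=> 0); split; last by move=> x _ [].
    - by move=> p [[x y] [/= _ y0] _]; move: y0; rewrite (noy y) eqxx.
    - by move=> p [[x y] [/= _ y0] _]; move: y0; rewrite (noy y) eqxx.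
    - by move=> x y _ _ [].
  have [e1 [e2 frame]] := exists_adapted_frame R m.
  exists (spray_alpha G e1 e2), (spray_beta G e1 e2); split.
  - exact: smooth_spray_alpha.
  - exact: smooth_spray_beta.
  - by move=> x y Ox y0 i; rewrite (representation OP sG invG frame Ox y0) !mxE.
  - by move=> x Ox i; rewrite zG // mxE.
have OUx : Omega (U *m x).
  have [W [WP _]] := radial_domain OP.
  by apply/WP; rewrite edot_orthogonal //; apply/WP.
have GE' x' y' : Omega x' -> y' != 0 -> G (x', y') =
    (enorm y' * alpha (rs (x', y'))) *: y' + (enorm y' ^+ 2 * beta (rs (x', y'))) *: x'.
  by move=> Ox' y'0; apply/colP => i; rewrite GE // !mxE.
(* Conversely, [enorm] and [edot] are invariant, so the coefficients agree at both points and the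
   combination of [x] and [y] is carried along by [U]. *)
rewrite !GE' ?mulmx_orthogonal_eq0 // mulmxDr -!scalemxAr /rs /=.
by rewrite !enorm_orthogonal // edot_orthogonal.
Qed.
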